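(* \textsc{Stars NWS} is W[1]-hard when parameterized by the number $c$ of communities, even if the input graph $G$ is a clique and every edge weight is $1$ or $2$.
   Context: An instance of \textsc{Stars NWS} consists of a graph $G$, a collection $\mathcal{C}$ of $c$ subsets of $V(G)$ (communities), an edge-weight function $\omega: E(G)\to \mathbb{R}_+$, an integer $\ell$, and a positive real $b$; the question is whether there is a spanning subgraph $G'=(V(G),E')$ with $E'\subseteq E(G)$, $|E'|\le \ell$ and $\omega(E')\le b$ such that for every $C\in\mathcal{C}$ some vertex of $C$ is adjacent in $G'$ to all other vertices of $C$. *)

(* Defs.v *)
From Corelib Require Import BinNums.
From HB Require Import structures.
From mathcomp Require Import all_boot all_order all_algebra.
From mathcomp Require Import reals.

Set Implicit Arguments.
Unset Strict Implicit.
Unset Printing Implicit Defensive.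

Import Order.TTheory GRing.Theory Num.Theory.

(** * Model of computation

    Jones's WHILE language over binary trees.  An assignment is charged the
    size of the tree it stores (not a unit cost), so that the store never
    outgrows the input plus the elapsed time, and running times are polynomially
    related to those of Turing machines. *)

Inductive data : Type := Leaf | Node of data & data.

Fixpoint dsize (d : data) : nat :=
  if d is Node a b then (dsize a + dsize b).+1 else 1.

Definition is_node (d : data) : bool := if d is Node _ _ then true else false.
Definition dhd (d : data) : data := if d is Node a _ then a else Leaf.
Definition dtl (d : data) : data := if d is Node _ b then b else Leaf.

Inductive expr : Type :=
  | EVar of nat
  | ELeaf
  | ENode of expr & expr
  | EHd of expr
  | ETl of expr.

Inductive cmd : Type :=
  | Skip
  | Assign of nat & expr
  | Seq of cmd & cmd
  | If of expr & cmd & cmd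
  | While of expr & cmd.

Definition store : Type := nat -> data.

Definition upd (s : store) (x : nat) (d : data) : store :=
  fun y => if y == x then d else s y.

Fixpoint eval (s : store) (e : expr) : data :=
  match e with
  | EVar x => s x
  | ELeaf => Leaf
  | ENode e1 e2 => Node (eval s e1) (eval s e2)
  | EHd e1 => dhd (eval s e1)
  | ETl e1 => dtl (eval s e1)
  end.

(** [exec c s t s']: started in [s], the command [c] halts in [s'] after time
    [t].  In tests [Leaf] is false and every other tree is true. *)
Inductive exec : cmd -> store -> nat -> store -> Prop :=
  | ExSkip s : exec Skip s 1 s
  | ExAssign s x e :
      exec (Assign x e) s (dsize (eval s e)).+1 (upd s x (eval s e))
  | ExSeq c1 c2 s s1 s2 t1 t2 :
      exec c1 s t1 s1 -> exec c2 s1 t2 s2 ->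
      exec (Seq c1 c2) s (t1 + t2).+1 s2
  | ExIfTrue e c1 c2 s s1 t :
      is_node (eval s e) -> exec c1 s t s1 -> exec (If e c1 c2) s t.+1 s1
  | ExIfFalse e c1 c2 s s1 t :
      ~~ is_node (eval s e) -> exec c2 s t s1 -> exec (If e c1 c2) s t.+1 s1
  | ExWhileTrue e c s s1 s2 t1 t2 :
      is_node (eval s e) -> exec c s t1 s1 -> exec (While e c) s1 t2 s2 ->
      exec (While e c) s (t1 + t2).+1 s2
  | ExWhileFalse e c s :
      ~~ is_node (eval s e) -> exec (While e c) s 1 s.

(** The input is read from, and the output left in, variable 0; all other
    variables are initially [Leaf]. *)
Definition runs (p : cmd) (input : data) (t : nat) (output : data) : Prop :=
  exists2 s, exec p (upd (fun=> Leaf) 0 input) t s & s 0 = output.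

(** * Encodings *)

Definition enc_bool (b : bool) : data := if b then Node Leaf Leaf else Leaf.

Definition enc_list (T : Type) (enc : T -> data) (s : seq T) : data :=
  foldr (fun x d => Node (enc x) d) Leaf s.

Fixpoint enc_unary (n : nat) : data :=
  if n is m.+1 then Node Leaf (enc_unary m) else Leaf.

(** Binary numbers are bit lists, least significant bit first. *)
Fixpoint enc_pos (p : positive) : data :=
  match p with
  | xH => Node (enc_bool true) Leaf
  | xO q => Node (enc_bool false) (enc_pos q)
  | xI q => Node (enc_bool true) (enc_pos q)
  end.

Definition enc_nat (n : nat) : data :=
  if bin_of_nat n is Npos p then enc_pos p else Leaf.

Definition enc_int (z : int) : data :=
  Node (enc_bool (z < 0)%R) (enc_nat `|z|%N).

Definition enc_rat (q : rat) : data :=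
  Node (enc_int (numq q)) (enc_nat `|denq q|%N).

(** * Parameterized problems and reductions *)

Definition pproblem : Type := data -> nat -> Prop.

Definition computable (f : nat -> nat) : Prop :=
  exists p : cmd, forall n, exists t, runs p (enc_unary n) t (enc_unary (f n)).

Definition fpt_time (r : data -> nat -> data * nat) : Prop :=
  exists (p : cmd) (f : nat -> nat) (c : nat), computable f /\
    forall x k, exists2 t,
      runs p (Node x (enc_unary k)) t
             (Node (r x k).1 (enc_unary (r x k).2))
      & t <= f k * dsize x ^ c.

Definition fpt_reduction (A B : pproblem) (r : data -> nat -> data * nat) :
    Prop :=
  [/\ forall x k, A x k <-> B (r x k).1 (r x k).2,
      exists2 g, computable g & forall x k, (r x k).2 <= g k
    & fpt_time r].

Definition fpt_reducible (A B : pproblem) : Prop :=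
  exists r, fpt_reduction A B r.

(** * Boolean circuits and the W-hierarchy *)

(** A circuit lists its nodes in topological order, a node referring to its
    in-neighbours by their positions; the output node is the last one. *)
Inductive gate : Type :=
  | Input
  | Not of nat
  | And of seq nat
  | Or of seq nat.

Definition circuit : Type := seq gate.

Definition preds (g : gate) : seq nat :=
  match g with
  | Input => [::]
  | Not j => [:: j]
  | And js => js
  | Or js => js
  end.

Definition is_input (g : gate) : bool := if g is Input then true else false.

Definition gate_ok (g : gate) : bool :=
  match g with
  | And js | Or js => uniq js && (1 < size js)
  | _ => true
  end.

Definition circuit_ok (C : circuit) : bool :=
  [&& 0 < size C, all gate_ok C
    & all (fun i => all (ltn^~ i) (preds (nth Input C i))) (iota 0 (size C))].

(** Node-by-node evaluation in topological order: [h vs g] is the value of the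
    gate [g], given the list [vs] of the values of all preceding nodes. *)
Definition sweep (T : Type) (h : seq T -> gate -> T) (C : circuit) : seq T :=
  foldl (fun vs g => rcons vs (h vs g)) [::] C.

Definition gate_value (a : pred nat) (vs : seq bool) (g : gate) : bool :=
  match g with
  | Input => a (size vs)
  | Not j => ~~ nth false vs j
  | And js => all (nth false vs) js
  | Or js => has (nth false vs) js
  end.

Definition circuit_value (C : circuit) (a : pred nat) : bool :=
  last false (sweep (gate_value a) C).

Definition gate_depth (ds : seq nat) (g : gate) : nat :=
  if is_input g then 0 else (\max_(j <- preds g) nth 0 ds j).+1.

(** Maximal length of a path from an input node to the output node. *)
Definition depth (C : circuit) : nat := last 0 (sweep gate_depth C).

Definition large (g : gate) : bool := 2 < size (preds g).

Definition gate_weft (ws : seq nat) (g : gate) : nat :=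
  large g + \max_(j <- preds g) nth 0 ws j.

(** Maximal number of large nodes on a path from an input node to the output
    node. *)
Definition weft (C : circuit) : nat := last 0 (sweep gate_weft C).

Definition weighted_sat (C : circuit) (k : nat) : Prop :=
  exists S : {set 'I_(size C)},
    [/\ forall i, i \in S -> is_input (nth Input C i),
        #|S| = k
      & circuit_value C (fun j => j \in [seq val i | i in S])].

Definition enc_gate (g : gate) : data :=
  match g with
  | Input => Node (enc_unary 0) Leaf
  | Not j => Node (enc_unary 1) (enc_unary j)
  | And js => Node (enc_unary 2) (enc_list enc_unary js)
  | Or js => Node (enc_unary 3) (enc_list enc_unary js)
  end.

Definition enc_circuit (C : circuit) : data := enc_list enc_gate C.

(** Weighted circuit satisfiability for circuits of weft at most [t] and depth
    at most [d]. *)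
Definition wcs (t d : nat) : pproblem := fun x k =>
  exists C : circuit,
    [/\ x = enc_circuit C, circuit_ok C, weft C <= t, depth C <= d
      & weighted_sat C k].

Definition W (t : nat) (A : pproblem) : Prop :=
  exists2 d, 0 < d & fpt_reducible A (wcs t d).

(** [B] is W[t]-hard even when restricted to the instances in [D]: every problem
    of W[t] has an fpt-reduction to [B] all of whose outputs lie in [D]. *)
Definition W_hard_on (t : nat) (B D : pproblem) : Prop :=
  forall A, W t A -> exists2 r, fpt_reduction A B r
                              & forall x k, D (r x k).1 (r x k).2.

(** * Stars NWS *)

(** The weight function is total on vertex sets; only its values on
    [edges] matter. *)
Record stars (R : Type) : Type := Stars {
  nverts : nat;
  edges : {set {set 'I_nverts}};
  communities : seq {set 'I_nverts};
  weight : {set 'I_nverts} -> R;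
  edge_bound : int;
  budget : R
}.
Arguments weight {R} _ _.

Definition valid_stars (R : realType) (I : stars R) : Prop :=
  [/\ forall e, e \in edges I -> #|e| = 2,
      uniq (communities I),
      forall e, e \in edges I -> (0 <= weight I e)%R
    & (0 < budget I)%R].

Definition star_in (n : nat) (F : {set {set 'I_n}}) (C : {set 'I_n}) : Prop :=
  exists2 u, u \in C & forall v, v \in C -> v != u -> [set u; v] \in F.

Definition stars_solvable (R : realType) (I : stars R) : Prop :=
  exists F : {set {set 'I_(nverts I)}},
    [/\ F \subset edges I,
        (#|F|%:Z <= edge_bound I)%R,
        (\sum_(e in F) weight I e <= budget I)%R
      & forall C, C \in communities I -> star_in F C].

Definition is_clique (R : Type) (I : stars R) : Prop :=
  forall u v : 'I_(nverts I), u != v -> [set u; v] \in edges I.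

Definition weights_1_or_2 (R : realType) (I : stars R) : Prop :=
  forall e, e \in edges I -> weight I e = 1%R \/ weight I e = 2%R.

(** Weighted adjacency matrix, characteristic vectors of the communities, edge
    bound and budget. *)
Definition enc_stars (I : stars rat) : data :=
  let V := enum 'I_(nverts I) in
  let enc_entry (e : {set 'I_(nverts I)}) :=
    if e \in edges I then Node Leaf (enc_rat (weight I e)) else Leaf in
  Node
    (Node (enc_list (fun u => enc_list (fun v => enc_entry [set u; v]) V) V)
          (enc_list (fun C : {set 'I_(nverts I)} =>
                       enc_list (fun v => enc_bool (v \in C)) V)
                    (communities I)))
    (Node (enc_int (edge_bound I)) (enc_rat (budget I))).

Definition real_stars (R : realType) (I : stars rat) : stars R :=
  @Stars R (nverts I) (edges I) (communities I)
    (fun e => ratr (weight I e)) (edge_bound I) (ratr (budget I)).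

(** [x] encodes the instance [I]; only instances whose weights and budget are
    rational have an encoding. *)
Definition encodes (R : realType) (x : data) (I : stars R) : Prop :=
  exists2 J : stars rat, x = enc_stars J & I = real_stars R J.

Definition stars_nws (R : realType) : pproblem := fun x k =>
  exists I : stars R,
    [/\ encodes x I, valid_stars I, size (communities I) = k
      & stars_solvable I].

Definition clique_instances_1_2 (R : realType) : pproblem := fun x k =>
  exists I : stars R,
    [/\ encodes x I, valid_stars I, size (communities I) = k,
        is_clique I & weights_1_or_2 I].

(* Main.v *)
Require Import Defs.
From Corelib Require Import BinNums.
From HB Require Import structures.
From mathcomp Require Import all_boot all_order all_algebra.
From mathcomp Require Import reals zify.

(** The satisfying assignments of weight [k] of a weft-1, depth-[d] circuit are
    described by boundedly many local views.  Write the true inputs in increasing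
    order [s_1 < ... < s_k], with sentinels [s_0] and [s_(k+1)].  A view is a
    tuple of [2^(d+1)] values [s_i], with their indices; two consecutive values
    also certify that the inputs strictly between them are false.  Every view
    carries the same list of [2^d] facts "node [v] has value [b]" from which the
    output is provably true.  Facts may be assumed only about inputs and about gates
    over weft-0 nodes whose claimed value is universal (a true [And], a false [Or]);
    if such a fact is false, then [2^d] inputs refute it, hence some view does.  Thus
    the circuit is satisfiable iff one can choose, for each of the [(k+2)^(2^(d+1))]
    index tuples, a view that does not refute its own facts, so that the views are
    pairwise compatible.

    This choice is a Stars instance with one community per index tuple.  All
    communities contain all views, and private vertices force the centre of a
    community to be a view of its index tuple.  A star with a legal centre has a
    fixed weight, so the only savings come from the edges between two centres,
    which are counted twice: they are maximal iff all these edges have weight 2,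
    that is, iff the centres are pairwise compatible.

    All of this is computable in time polynomial in the input and [k], since [d] is
    a constant; the running times follow from closure properties of the class
    [ptime] of functions with a polynomial-time WHILE program. *)

Set Implicit Arguments.
Unset Strict Implicit.
Unset Printing Implicit Defensive.

(** * Polynomial-time WHILE programs *)

(** An assignment is charged the size of the tree it stores, so the last assignment to a variable
    already pays for its final value. This turns time bounds into size bounds. *)
Lemma exec_size c s t s' : exec c s t s' ->
  forall x, s' x = s x \/ dsize (s' x) <= t.
Proof.
elim=> {c s t s'}.
- by left.
- move=> s x e y; rewrite /upd; case: eqP => _; [by right | by left].
- move=> c1 c2 s s1 s2 t1 t2 _ IH1 _ IH2 x.
  case: (IH2 x) => [->|]; last by right; lia.
  by case: (IH1 x) => [->|]; [left | right; lia].
- by move=> e c1 c2 s s1 t _ _ IH x; case: (IH x); [left | right; lia].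
- by move=> e c1 c2 s s1 t _ _ IH x; case: (IH x); [left | right; lia].
- move=> e c s s1 s2 t1 t2 _ _ IH1 _ IH2 x.
  case: (IH2 x) => [->|]; last by right; lia.
  by case: (IH1 x) => [->|]; [left | right; lia].
- by left.
Qed.

Class Enc (T : Type) := enc : T -> data.
Arguments enc : simpl never.
Arguments dsize : simpl never.

Lemma dsize_Node a b : dsize (Node a b) = (dsize a + dsize b).+1.
Proof. by []. Qed.

#[global] Instance Enc_data : Enc data := fun d => d.
#[global] Instance Enc_unit : Enc unit := fun=> Leaf.
#[global] Instance Enc_bool : Enc bool := enc_bool.
#[global] Instance Enc_nat : Enc nat := enc_unary.
#[global] Instance Enc_gate : Enc gate := enc_gate.
#[global] Instance Enc_prod A B {EA : Enc A} {EB : Enc B} : Enc (A * B) :=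
  fun p => Node (enc p.1) (enc p.2).
#[global] Instance Enc_seq A {EA : Enc A} : Enc (seq A) := enc_list enc.

Lemma enc_cons A {EA : Enc A} (x : A) l : enc (x :: l) = Node (enc x) (enc l).
Proof. by []. Qed.

Lemma enc_pair A B {EA : Enc A} {EB : Enc B} (p : A * B) :
  enc p = Node (enc p.1) (enc p.2).
Proof. by []. Qed.

(** The successor makes every size at least 2, so that a bare power of [sz], without coefficient or
    lower-order term, absorbs constants and sums. *)
Definition sz {A} {EA : Enc A} (a : A) : nat := (dsize (enc a)).+1.

Lemma dsize_gt0 d : 0 < dsize d. Proof. by case: d. Qed.

Lemma dsize_dhd d : dsize (dhd d) <= dsize d.
Proof. by case: d => //= a b; rewrite dsize_Node; lia. Qed.

Lemma dsize_dtl d : dsize (dtl d) <= dsize d.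
Proof. by case: d => //= a b; rewrite dsize_Node; lia. Qed.

Lemma sz_gt1 A {EA : Enc A} (a : A) : 1 < sz a.
Proof. by rewrite ltnS dsize_gt0. Qed.

Definition pbounded {A} {EA : Enc A} (g : A -> nat) : Prop :=
  exists c, forall a, g a <= sz a ^ c.

Section Pbounded.
Context {A : Type} {EA : Enc A}.
Implicit Types g h : A -> nat.

Lemma pb_le g h : (forall a, g a <= h a) -> pbounded h -> pbounded g.
Proof. by move=> gh [c hc]; exists c => a; apply: leq_trans (gh a) (hc a). Qed.

Lemma pb_const n : pbounded (fun _ : A => n).
Proof.
exists n => a; apply: (@leq_trans (2 ^ n)); first exact: ltnW (ltn_expl _ _).
by case: n => [//|n]; rewrite leq_exp2r // sz_gt1.
Qed.

Lemma pb_sz : pbounded (fun a : A => sz a).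
Proof. by exists 1 => a; rewrite expn1. Qed.

Lemma pb_mul g h : pbounded g -> pbounded h -> pbounded (fun a => g a * h a).
Proof.
by move=> [c gc] [c' hc]; exists (c + c') => a; rewrite expnD leq_mul.
Qed.

Lemma pb_add g h : pbounded g -> pbounded h -> pbounded (fun a => g a + h a).
Proof.
move=> [c gc] [c' hc]; exists (maxn c c').+1 => a.
have lt1 : 1 < sz a by exact: sz_gt1.
have lt0 := ltnW lt1.
apply: (@leq_trans (2 * sz a ^ maxn c c')); last first.
  by rewrite expnS leq_mul2r lt1 orbT.
rewrite mul2n -addnn leq_add //.
  by apply: leq_trans (gc a) _; rewrite leq_pexp2l ?leq_maxl.
by apply: leq_trans (hc a) _; rewrite leq_pexp2l ?leq_maxr.
Qed.

Lemma pb_exp g n : pbounded g -> pbounded (fun a => g a ^ n).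
Proof.
move=> [c gc]; exists (c * n) => a.
by rewrite expnM; case: n => // n; rewrite leq_exp2r.
Qed.

Lemma pb_comp {B} {EB : Enc B} (g : B -> nat) (f : A -> B) :
  pbounded g -> pbounded (fun a => sz (f a)) -> pbounded (fun a => g (f a)).
Proof. by move=> [c gc] pf; apply: (pb_le (fun a => gc (f a))); apply: pb_exp. Qed.

End Pbounded.

Ltac pb := first [ eassumption | exact pb_sz | lazymatch goal with
  | |- pbounded (fun a => addn (@?f a) (@?g a)) => refine (@pb_add _ _ f g _ _); pb
  | |- pbounded (fun a => muln (@?f a) (@?g a)) => refine (@pb_mul _ _ f g _ _); pb
  | |- pbounded (fun a => expn (@?f a) ?n) => refine (@pb_exp _ _ f n _); pb
  | |- pbounded (fun _ => ?n) => refine (pb_const n)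
  end | idtac ].

(** The program is relative to a base variable [b]: argument and result live in [b], smaller
    variables are preserved, and larger ones are scratch space with arbitrary initial content.
    Programs thus combine without renaming. *)
Definition ptime {A B} {EA : Enc A} {EB : Enc B} (f : A -> B) : Prop :=
  exists (P : nat -> cmd) (T : A -> nat), pbounded T /\
    forall b s a, s b = enc a -> exists t s',
      [/\ exec (P b) s t s', s' b = enc (f a), forall y, y < b -> s' y = s y
        & t <= T a].

(** By [exec_size], the result is either the tree of the argument itself or paid for by the running
    time. Composition uses this to bound the time of the second program. *)
Lemma ptime_size A B {EA : Enc A} {EB : Enc B} (f : A -> B) :
  ptime f -> pbounded (fun a => sz (f a)).
Proof.
case=> P [T [pT H]].
apply: (@pb_le _ _ _ (fun a => T a + sz a + 1)); last first.
  by pb.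
move=> a; have [t [s' [ex eqb _ le_t]]] := H 0 (fun=> enc a) a erefl.
rewrite /sz -eqb; case: (exec_size ex 0) => [->|]; lia.
Qed.

Lemma eq_ptime A B {EA : Enc A} {EB : Enc B} (f g : A -> B) :
  f =1 g -> ptime f -> ptime g.
Proof.
move=> fg [P [T [pT H]]]; exists P, T; split=> // b s a sb.
by have [t [s' [ex eqb fr le]]] := H b s a sb; exists t, s'; rewrite -fg.
Qed.

(** Changes of type that leave the tree alone cost nothing; several operations below are reduced to
    this case. *)
Lemma ptime_recode A B {EA : Enc A} {EB : Enc B} (f : A -> B) :
  (forall a, enc (f a) = enc a) -> ptime f.
Proof.
move=> fE; exists (fun=> Skip), (fun=> 1); split; first exact: pb_const.
by move=> b s a sb; exists 1, s; split=> //; [constructor | rewrite fE].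
Qed.

Lemma ptime_id A {EA : Enc A} : ptime (fun a : A => a).
Proof. exact: ptime_recode. Qed.

Lemma ptime_expr A B {EA : Enc A} {EB : Enc B} (f : A -> B) (e : nat -> expr) :
  (forall b s a, s b = enc a -> eval s (e b) = enc (f a)) ->
  pbounded (fun a => sz (f a)) -> ptime f.
Proof.
move=> He pf; exists (fun b => Assign b (e b)), (fun a => sz (f a)); split=> //.
move=> b s a sb; eexists _, _; split; first exact: ExAssign.
- by rewrite /upd eqxx (He _ _ _ sb).
- by move=> y yb; rewrite /upd; case: eqP yb => // ->; rewrite ltnn.
- by rewrite (He _ _ _ sb).
Qed.

Fixpoint edata (d : data) : expr :=
  if d is Node a b then ENode (edata a) (edata b) else ELeaf.

Lemma eval_edata s d : eval s (edata d) = d.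
Proof. by elim: d => //= a -> b ->. Qed.

Lemma ptime_const A B {EA : Enc A} {EB : Enc B} (c : B) : ptime (fun _ : A => c).
Proof.
apply: (@ptime_expr _ _ _ _ _ (fun=> edata (enc c))); last exact: pb_const.
by move=> *; rewrite eval_edata.
Qed.

Lemma ptime_comp A B C {EA : Enc A} {EB : Enc B} {EC : Enc C}
    (g : B -> C) (f : A -> B) :
  ptime g -> ptime f -> ptime (fun a => g (f a)).
Proof.
move=> pg pf; have pfs := ptime_size pf.
case: pf pg => P [T [pT H]] [P' [T' [pT' H']]].
exists (fun b => Seq (P b) (P' b)), (fun a => T a + T' (f a) + 1); split.
  by pb; exact: pb_comp pT' pfs.
move=> b s a sb; have [t [s1 [ex1 eq1 fr1 le1]]] := H b s a sb.
have [t' [s2 [ex2 eq2 fr2 le2]]] := H' b s1 _ eq1.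
exists (t + t').+1, s2; split => //; first exact: ExSeq ex1 ex2.
- by move=> y yb; rewrite fr2 ?fr1.
- lia.
Qed.

Lemma upd_eq s x d : upd s x d x = d. Proof. by rewrite /upd eqxx. Qed.

Lemma upd_neq s x d y : y != x -> upd s x d y = s y.
Proof. by rewrite /upd => /negbTE->. Qed.

(** The two computations run on copies in [b.+1] and [b.+2], above the argument, which survives in
    [b] until the pair is formed. *)
Lemma ptime_pair A B C {EA : Enc A} {EB : Enc B} {EC : Enc C}
    (f : A -> B) (g : A -> C) :
  ptime f -> ptime g -> ptime (fun a => (f a, g a)).
Proof.
move=> pf pg; have [pfs pgs] := (ptime_size pf, ptime_size pg).
case: pf pg => P [T [pT H]] [P' [T' [pT' H']]].
exists (fun b => Seq (Assign b.+1 (EVar b)) (Seq (P b.+1)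
         (Seq (Assign b.+2 (EVar b)) (Seq (P' b.+2)
           (Assign b (ENode (EVar b.+1) (EVar b.+2))))))),
       (fun a => T a + T' a + 2 * sz a + sz (f a) + sz (g a) + 10); split.
  by pb.
move=> b s a sb.
have [t1 [s1 [ex1 eq1 fr1 le1]]] := H b.+1 (upd s b.+1 (s b)) a
  (etrans (upd_eq _ _ _) sb).
have s1b : s1 b = enc a by rewrite fr1 // upd_neq //; lia.
have [t2 [s2 [ex2 eq2 fr2 le2]]] := H' b.+2 (upd s1 b.+2 (s1 b)) a
  (etrans (upd_eq _ _ _) s1b).
have s2b : s2 b.+1 = enc (f a) by rewrite fr2 // upd_neq ?eq1 //; lia.
eexists _, _; split.
- by do 4!(eapply ExSeq; [first [exact: ExAssign | eassumption] |]); exact: ExAssign.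
- by rewrite upd_eq /= s2b eq2.
- move=> y yb; rewrite upd_neq; last lia.
  rewrite fr2 ?upd_neq ?fr1 ?upd_neq //; lia.
- rewrite /= dsize_Node s2b eq2 s1b sb /sz; lia.
Qed.

Lemma ptime_comp2 A B C D {EA : Enc A} {EB : Enc B} {EC : Enc C} {ED : Enc D}
    (F : B -> C -> D) (f : A -> B) (g : A -> C) :
  ptime (fun p : B * C => F p.1 p.2) -> ptime f -> ptime g ->
  ptime (fun a => F (f a) (g a)).
Proof. by move=> pF pf pg; exact: ptime_comp pF (ptime_pair pf pg). Qed.

Lemma ptime_fst A B {EA : Enc A} {EB : Enc B} : ptime (fun p : A * B => p.1).
Proof.
apply: (@ptime_expr _ _ _ _ _ (fun b => EHd (EVar b))) => [b s a /= ->//|].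
by apply: pb_le pb_sz => -[a b]; rewrite /sz enc_pair !dsize_Node /=; lia.
Qed.

Lemma ptime_snd A B {EA : Enc A} {EB : Enc B} : ptime (fun p : A * B => p.2).
Proof.
apply: (@ptime_expr _ _ _ _ _ (fun b => ETl (EVar b))) => [b s a /= ->//|].
by apply: pb_le pb_sz => -[a b]; rewrite /sz enc_pair !dsize_Node /=; lia.
Qed.

Lemma ptime_if A B {EA : Enc A} {EB : Enc B} (c : A -> bool) (f g : A -> B) :
  ptime c -> ptime f -> ptime g -> ptime (fun a => if c a then f a else g a).
Proof.
move=> pc pf pg.
case: pc pf pg => Pc [Tc [pTc Hc]] [P [T [pT H]]] [P' [T' [pT' H']]].
exists (fun b => Seq (Assign b.+1 (EVar b)) (Seq (Pc b.+1)
         (If (EVar b.+1) (P b) (P' b)))),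
       (fun a => Tc a + T a + T' a + sz a + 10); split.
  by pb.
move=> b s a sb.
have [t1 [s1 [ex1 eq1 fr1 le1]]] := Hc b.+1 (upd s b.+1 (s b)) a
  (etrans (upd_eq _ _ _) sb).
have s1b : s1 b = enc a by rewrite fr1 // upd_neq //; lia.
have fr y : y < b -> s1 y = s y by move=> yb; rewrite fr1 ?upd_neq //; lia.
case ca: (c a).
  have [t2 [s2 [ex2 eq2 fr2 le2]]] := H b s1 a s1b.
  eexists _, s2; split.
  - apply: ExSeq; first exact: ExAssign.
    by apply: ExSeq ex1 _; apply: ExIfTrue ex2; rewrite /= eq1 ca.
  - by rewrite eq2.
  - by move=> y yb; rewrite fr2 ?fr.
  - by rewrite /= sb /sz; lia.
have [t2 [s2 [ex2 eq2 fr2 le2]]] := H' b s1 a s1b.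
eexists _, s2; split.
- apply: ExSeq; first exact: ExAssign.
  by apply: ExSeq ex1 _; apply: ExIfFalse ex2; rewrite /= eq1 ca.
- by rewrite eq2.
- by move=> y yb; rewrite fr2 ?fr.
- by rewrite /= sb /sz; lia.
Qed.

Lemma ptime_cons A B {EA : Enc A} {EB : Enc B} (f : A -> B) (g : A -> seq B) :
  ptime f -> ptime g -> ptime (fun a => f a :: g a).
Proof.
apply: (ptime_comp2 (F := fun x (l : seq B) => x :: l)).
exact: ptime_recode.
Qed.

Lemma dsize_behead A {EA : Enc A} (l : seq A) :
  dsize (enc (behead l)) <= dsize (enc l).
Proof. by case: l => //= x l; rewrite enc_cons dsize_Node /=; lia. Qed.

Lemma ptime_behead A B {EA : Enc A} {EB : Enc B} (g : A -> seq B) :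
  ptime g -> ptime (fun a => behead (g a)).
Proof.
move=> pg; refine (ptime_comp (g := fun l : seq B => behead l) _ pg).
apply: (@ptime_expr _ _ _ _ _ (fun b => ETl (EVar b))).
  by move=> b s [|x l] /= ->.
by apply: pb_le pb_sz => l; rewrite ltnS dsize_behead.
Qed.

Lemma ptime_nilp A B {EA : Enc A} {EB : Enc B} (g : A -> seq B) :
  ptime g -> ptime (fun a => nilp (g a)).
Proof.
move=> pg.
refine (ptime_comp (g := fun l : seq B => nilp l) _ pg).
exists (fun b => If (EVar b) (Assign b ELeaf) (Assign b (ENode ELeaf ELeaf))).
exists (fun=> 10); split; first exact: pb_const.
move=> b s [|x l] sb.
  eexists _, _; split.
  - by apply: ExIfFalse; [rewrite /= sb | exact: ExAssign].
  - by rewrite upd_eq.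
  - by move=> y yb; rewrite upd_neq //; lia.
  - by [].
eexists _, _; split.
- by apply: ExIfTrue; [rewrite /= sb | exact: ExAssign].
- by rewrite upd_eq.
- by move=> y yb; rewrite upd_neq //; lia.
- by [].
Qed.

Lemma ptime_head A B {EA : Enc A} {EB : Enc B} (x0 : B) (g : A -> seq B) :
  ptime g -> ptime (fun a => head x0 (g a)).
Proof.
move=> pg; refine (ptime_comp (g := fun l : seq B => head x0 l) _ pg).
have pH : ptime (fun l : seq B => if nilp l then enc x0 else dhd (enc l)).
  apply: ptime_if; [exact: ptime_nilp ptime_id | exact: ptime_const |].
  apply: (@ptime_expr _ _ _ _ _ (fun b => EHd (EVar b))) => [b s a /= ->//|].
  by apply: pb_le pb_sz => l; rewrite ltnS dsize_dhd.
case: pH => P [T [pT H]]; exists P, T; split=> // b s l sb.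
by have [t [s' [? eq1 ? ?]]] := H b s l sb; exists t, s'; split=> //; rewrite eq1; case: (l).
Qed.

Lemma size_le_dsize A {EA : Enc A} (l : seq A) : size l <= dsize (enc l).
Proof. by elim: l => //= x l IH; rewrite enc_cons dsize_Node /=; lia. Qed.

Section Foldl.
Context {A S X : Type} {EA : Enc A} {ES : Enc S} {EX : Enc X}.
Variable step : A -> S -> X -> S.

(** Variable [b] holds the parameter, [b.+1] the remaining list, [b.+2] the state; the step runs in
    [b.+3]. *)
Definition fold_body (P : nat -> cmd) b : cmd :=
  Seq (Assign b.+3 (ENode (ENode (EVar b) (EVar b.+2)) (EHd (EVar b.+1))))
  (Seq (P b.+3) (Seq (Assign b.+2 (EVar b.+3)) (Assign b.+1 (ETl (EVar b.+1))))).

(** [Z] bounds the size of every argument passed to the step, so one round costs at most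
    [Z ^ c + 3 * Z + 10]. *)
Lemma fold_loop (P : nat -> cmd) (c : nat) (a : A) (Z : nat) :
  (forall b s (z : A * S * X), s b = enc z -> exists t s',
    [/\ exec (P b) s t s', s' b = enc (step z.1.1 z.1.2 z.2),
        forall y, y < b -> s' y = s y & t <= sz z ^ c]) ->
  forall (l : seq X) (st : S) b s,
  s b = enc a -> s b.+1 = enc l -> s b.+2 = enc st ->
  dsize (enc a) + dsize (enc l) + 3 <= Z ->
  (forall i, dsize (enc a) + dsize (enc l) + 3 +
             dsize (enc (foldl (step a) st (take i l))) <= Z) ->
  exists t s', [/\ exec (While (EVar b.+1) (fold_body P b)) s t s',
    s' b.+2 = enc (foldl (step a) st l),
    forall y, y < b -> s' y = s y & t <= (size l).+1 * (Z ^ c + 3 * Z + 10)].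
Proof.
move=> H; elim=> [|x l IH] st b s sb sb1 sb2 le1 leZ.
  exists 1, s; split=> //; last by lia.
  by apply: ExWhileFalse; rewrite /= sb1.
pose s0 := upd s b.+3 (Node (Node (s b) (s b.+2)) (dhd (s b.+1))).
have s0b : s0 b.+3 = enc (a, st, x) by rewrite /s0 upd_eq sb sb1 sb2.
have [t1 [s1 [ex1 eq1 fr1 le_t1]]] := H b.+3 s0 _ s0b.
rewrite [RHS]/= in eq1.
pose s2 := upd s1 b.+2 (s1 b.+3).
pose s3 := upd s2 b.+1 (dtl (s2 b.+1)).
have s2b1 : s2 b.+1 = enc (x :: l).
  by rewrite /s2 upd_neq ?fr1 /s0 ?upd_neq //; lia.
have [|||||t2 [s4 [ex2 eq2 fr2 le_t2]]] := IH (step a st x) b s3.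
- by rewrite /s3 /s2 !upd_neq ?fr1 /s0 ?upd_neq //; lia.
- by rewrite /s3 upd_eq s2b1.
- by rewrite /s3 /s2 upd_neq ?upd_eq //; lia.
- by move: le1; rewrite enc_cons dsize_Node /=; lia.
- move=> i; have := leZ i.+1; rewrite /= enc_cons dsize_Node /=; lia.
eexists _, s4; split.
- apply: ExWhileTrue ex2; first by rewrite /= sb1.
  apply: ExSeq; first exact: ExAssign.
  apply: ExSeq ex1 _.
  by apply: ExSeq; apply: ExAssign.
- by rewrite eq2.
- move=> y yb; rewrite fr2 // /s3 /s2 !upd_neq ?fr1 /s0 ?upd_neq //; lia.
- rewrite /= sb sb1 sb2 eq1 enc_cons !dsize_Node /=.
  have e : dsize (enc (x :: l)) = (dsize (enc x) + dsize (enc l)).+1 by [].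
  have eh : dtl (upd s1 b.+2 (s1 b.+3) b.+1) = enc l by rewrite -/s2 s2b1.
  rewrite -eq1 eh eq1.
  have le0 := leZ 0; rewrite /= e in le0.
  have le2 := leZ 1; rewrite /= take0 /= e in le2.
  have le3 : sz (a, st, x) ^ c <= Z ^ c.
    case: (c) => // c'; rewrite leq_exp2r // /sz !enc_pair !dsize_Node /=; lia.
  move: (leq_trans le_t1 le3) le_t2; rewrite (mulSn (size l).+1).
  move: (Z ^ c) => u; move: ((size l).+1 * _) => w ??. lia.
Qed.

(** A polynomial step alone could let the state grow exponentially under iteration; the bound [B] on
    all intermediate states excludes this. *)
Lemma ptime_foldl (st : A -> S) (l : A -> seq X) :
  ptime (fun z : A * S * X => step z.1.1 z.1.2 z.2) -> ptime st -> ptime l ->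
  (exists2 B, pbounded B &
    forall a i, dsize (enc (foldl (step a) (st a) (take i (l a)))) <= B a) ->
  ptime (fun a => foldl (step a) (st a) (l a)).
Proof.
move=> [P [T [[c cT] H]]] ps pl [B pB leB].
have [pss pls] := (ptime_size ps, ptime_size pl).
case: ps pl => [Ps [Ts [pTs Hs]]] [Pl [Tl [pTl Hl]]].
set (Z := fun a : A => sz a + sz (l a) + 3 + B a + 1).
exists (fun b => Seq (Assign b.+1 (EVar b)) (Seq (Pl b.+1)
         (Seq (Assign b.+2 (EVar b)) (Seq (Ps b.+2)
         (Seq (While (EVar b.+1) (fold_body P b)) (Assign b (EVar b.+2))))))),
  (fun a => Tl a + Ts a + 2 * sz a + 20 + (sz (l a)) * (Z a ^ c + 3 * Z a + 10) + B a); split.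
  have pZ : pbounded Z by rewrite /Z; pb.
  by pb.
move=> b s a sb.
have [t1 [s1 [ex1 eq1 fr1 le1]]] := Hl b.+1 (upd s b.+1 (s b)) a
  (etrans (upd_eq _ _ _) sb).
have s1b : s1 b = enc a by rewrite fr1 // upd_neq //; lia.
have [t2 [s2 [ex2 eq2 fr2 le2]]] := Hs b.+2 (upd s1 b.+2 (s1 b)) a
  (etrans (upd_eq _ _ _) s1b).
have s2b1 : s2 b.+1 = enc (l a) by rewrite fr2 // upd_neq ?eq1 //; lia.
have s2b : s2 b = enc a by rewrite fr2 // upd_neq ?s1b //; lia.
have [|||t3 [s3 [ex3 eq3 fr3 le3]]] :=
    @fold_loop P c a (Z a) _ (l a) (st a) b s2 s2b s2b1 eq2.
- move=> b' s' z sb'; have [t [s'' [? ? ? le]]] := H b' s' z sb'.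
  by exists t, s''; split=> //; apply: leq_trans le (cT z).
- by rewrite /Z /sz; lia.
- by move=> i; have := leB a i; rewrite /Z /sz; lia.
eexists _, _; split.
- by do 5!(eapply ExSeq; [first [exact: ExAssign | eassumption] |]); exact: ExAssign.
- by rewrite upd_eq.
- move=> y yb; rewrite upd_neq; last lia.
  rewrite fr3 // fr2 ?upd_neq ?fr1 ?upd_neq //; lia.
- rewrite /= eq3 s1b sb; have := leB a (size (l a)); rewrite take_size => ?.
  have le4 : t3 <= sz (l a) * (Z a ^ c + 3 * Z a + 10).
    by apply: leq_trans le3 _; rewrite leq_mul2r orbC ltnS size_le_dsize.
  by move: (_ * (Z a ^ c + 3 * Z a + 10)) le4 => u le4; rewrite /sz; lia.
Qed.

End Foldl.

(* Proof search for [ptime] *)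
Create HintDb ptime discriminated.
#[global] Hint Constants Opaque : ptime.
#[global] Hint Variables Opaque : ptime.
#[global] Hint Resolve ptime_fst ptime_snd : ptime.

Lemma ptime_comp3 A B C D E {EA : Enc A} {EB : Enc B} {EC : Enc C} {ED : Enc D}
    {EE : Enc E} (F : B -> C -> D -> E) (f : A -> B) (g : A -> C) (h : A -> D) :
  ptime (fun p : B * C * D => F p.1.1 p.1.2 p.2) -> ptime f -> ptime g -> ptime h ->
  ptime (fun a => F (f a) (g a) (h a)).
Proof.
by move=> pF pf pg ph; exact: ptime_comp pF (ptime_pair (ptime_pair pf pg) ph).
Qed.

(** Hooks, redefined once the lemmas on equality, on operators with a function argument and on
    [uniq] are available. *)
Ltac pt_binder := fail.
Ltac pt_special := fail.

Ltac pt1 := first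
  [ pt_binder
  | pt_special
  | match goal with |- ptime (fun a => ?F (@?f a)) =>
      refine (ptime_comp (g := F) (f := f) _ _); [solve [eauto with ptime] |]
    end
  | match goal with |- ptime (fun a => ?F (@?f a) (@?g a)) =>
      refine (ptime_comp2 (F := F) (f := f) (g := g) _ _ _);
        [solve [eauto with ptime] | |]
    end
  | match goal with |- ptime (fun a => ?F (@?f a) (@?g a) (@?h a)) =>
      refine (ptime_comp3 (F := F) (f := f) (g := g) (h := h) _ _ _ _);
        [solve [eauto with ptime] | | |]
    end
  | solve [eauto with ptime]
  | lazymatch goal with |- ptime (fun _ => if _ then _ else _) =>
      refine (ptime_if _ _ _) end ].

(* Types that come from generic [eqType] operations are put in normal form, since
   the hints are used with opaque constants. *)
Ltac pt_norm := cbv beta;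
  try change (Equality.sort Datatypes_nat__canonical__eqtype_Equality) with nat;
  try change (Equality.sort Datatypes_bool__canonical__eqtype_Equality) with bool.

Ltac pt := pt_norm; lazymatch goal with
  | |- ptime (fun _ => ?c) => exact (ptime_const c)
  | |- ptime (fun a => a) => exact ptime_id
  | |- ptime (fun a => pair (@?f a) (@?g a)) =>
      refine (ptime_pair (f := f) (g := g) _ _); pt
  | |- ptime (fun a => cons (@?f a) (@?g a)) =>
      refine (ptime_cons (f := f) (g := g) _ _); pt
  | |- ptime _ => tryif pt1 then pt else idtac
  | _ => idtac
  end.

(** * List operations in polynomial time *)

Lemma dsize_enc_seq A {EA : Enc A} (l : seq A) :
  dsize (enc l) = (\sum_(x <- l) sz x).+1.
Proof.
elim: l => [|x l IH]; first by rewrite big_nil.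
by rewrite big_cons enc_cons dsize_Node IH /sz; lia.
Qed.

Lemma dsize_take A {EA : Enc A} i (l : seq A) :
  dsize (enc (take i l)) <= dsize (enc l).
Proof.
by rewrite !dsize_enc_seq -{2}(cat_take_drop i l) big_cat /= ltnS leq_addr.
Qed.

Lemma eq_foldl A B (f g : A -> B -> A) : (forall a b, f a b = g a b) ->
  forall a s, foldl f a s = foldl g a s.
Proof. by move=> fg a s; elim: s a => //= x s IH a; rewrite fg IH. Qed.

Lemma foldl_cons_rev A B (f : A -> B) (s : seq B) l :
  foldl (fun s x => f x :: s) s l = rev (map f l) ++ s.
Proof. by elim: l s => //= x l IH s; rewrite IH rev_cons cat_rcons. Qed.

Lemma ptime_rev A {EA : Enc A} : ptime (@rev A).
Proof.
apply: (@eq_ptime _ _ _ _ (fun l => foldl (fun s x => x :: s) [::] l)).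
  by move=> l; rewrite (foldl_cons_rev id) map_id cats0.
apply: (@ptime_foldl _ _ _ _ _ _ (fun _ s x => x :: s) (fun=> [::]) id); try by pt.
exists (fun l => sz l); first exact: pb_sz.
move=> l i; rewrite (foldl_cons_rev id) map_id cats0 /sz !dsize_enc_seq.
rewrite big_rev /=.
have : dsize (enc (take i l)) <= dsize (enc l) by exact: dsize_take.
by rewrite !dsize_enc_seq; lia.
Qed.
#[global] Hint Resolve ptime_rev : ptime.

Lemma ptime_cat A {EA : Enc A} : ptime (fun p : seq A * seq A => p.1 ++ p.2).
Proof.
apply: (@eq_ptime _ _ _ _ (fun p => foldl (fun s x => x :: s) p.2 (rev p.1))).
  by move=> p; rewrite (foldl_cons_rev id) map_id revK.
apply: (@ptime_foldl _ _ _ _ _ _ (fun _ s x => x :: s)); try by pt.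
exists (fun l => sz l); first exact: pb_sz.
move=> [l l'] i /=; rewrite (foldl_cons_rev id) map_id /sz enc_pair dsize_Node /=.
rewrite dsize_enc_seq big_cat /= big_rev /=.
have : dsize (enc (take i (rev l))) <= dsize (enc (rev l)) by exact: dsize_take.
rewrite !dsize_enc_seq.
rewrite big_rev /=; lia.
Qed.
#[global] Hint Resolve ptime_cat : ptime.

(** Each element is a subtree of the list, so all values of [f] are bounded by one polynomial in the
    sizes of the argument and the list. The fold builds the result in reverse. *)
Lemma ptime_map A X Y {EA : Enc A} {EX : Enc X} {EY : Enc Y}
    (f : A -> X -> Y) (l : A -> seq X) :
  ptime (fun z : A * X => f z.1 z.2) -> ptime l ->
  ptime (fun a => [seq f a x | x <- l a]).
Proof.
move=> pf pl; have pls := ptime_size pl; have [c cf] := ptime_size pf.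
apply: (@eq_ptime _ _ _ _
  (fun a => rev (foldl (fun s x => f a x :: s) [::] (l a)))).
  by move=> a; rewrite foldl_cons_rev cats0 revK.
apply: (ptime_comp (@ptime_rev _ _)).
apply: (@ptime_foldl _ _ _ _ _ _ (fun a s x => f a x :: s) (fun=> [::])) => //.
- apply: ptime_cons; last by pt.
  refine (ptime_comp (g := fun z => f z.1 z.2)
    (f := fun z : A * seq Y * X => (z.1.1, z.2)) _ _) => //; pt.
- exact: ptime_const.
exists (fun a => (sz (l a) * (sz a + sz (l a)) ^ c).+1).
  apply: (@pb_le _ _ _ (fun a => sz (l a) * (sz a + sz (l a)) ^ c + 1)) => [a|].
    by rewrite addn1.
  have ? : pbounded (@sz A _) by exact: pb_sz.
  by pb.
move=> a i; rewrite foldl_cons_rev cats0 dsize_enc_seq ltnS.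
rewrite big_rev /= big_map.
apply: (@leq_trans (\sum_(x <- l a) sz (f a x))).
  by rewrite -{2}(cat_take_drop i (l a)) big_cat leq_addr.
apply: (@leq_trans (\sum_(x <- l a) (sz a + sz (l a)) ^ c)); last first.
  rewrite big_const_seq iter_addn_0 mulnC leq_mul2r count_predT.
  by rewrite leqW ?orbT // size_le_dsize.
(* The size of the full list is frozen as [N], so that the induction can run over suffixes. *)
have : sz (l a) <= sz (l a) by [].
move: {2 3}(sz (l a)) => N.
elim: (l a) => [|x s IH] le; first by rewrite !big_nil.
rewrite !big_cons leq_add //.
  apply: leq_trans (cf (a, x)) _; case: (c) => // c'; rewrite leq_exp2r //.
  move: le; rewrite /sz enc_cons enc_pair !dsize_Node /=.
  by lia.
apply: IH; apply: leq_trans le; rewrite /sz enc_cons dsize_Node; lia.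
Qed.

Lemma foldl_cat_flatten A (s : seq A) ls : foldl cat s ls = s ++ flatten ls.
Proof. by elim: ls s => [|l ls IH] s /=; rewrite ?cats0 // IH catA. Qed.

Lemma dsize_flatten A {EA : Enc A} (ls : seq (seq A)) :
  dsize (enc (flatten ls)) <= dsize (enc ls).
Proof.
elim: ls => // l ls IH; rewrite enc_cons dsize_Node /= dsize_enc_seq big_cat /=.
by move: IH; rewrite (dsize_enc_seq (flatten ls)) (dsize_enc_seq l); lia.
Qed.

Lemma ptime_flatten A {EA : Enc A} : ptime (@flatten A).
Proof.
apply: (@eq_ptime _ _ _ _ (fun ls => foldl cat [::] ls)).
  by move=> ls; rewrite foldl_cat_flatten.
apply: (@ptime_foldl _ _ _ _ _ _ (fun _ s x => s ++ x) (fun=> [::]) id); try by pt.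
exists (fun ls => sz ls); first exact: pb_sz.
move=> ls i; rewrite foldl_cat_flatten /=.
by apply: leq_trans (dsize_flatten _) _; apply: leq_trans (dsize_take _ _) _.
Qed.
#[global] Hint Resolve ptime_flatten : ptime.

Lemma ptime_filter A X {EA : Enc A} {EX : Enc X} (p : A -> X -> bool) l :
  ptime (fun z : A * X => p z.1 z.2) -> ptime l ->
  ptime (fun a => [seq x <- l a | p a x]).
Proof.
move=> pp pl; apply: (@eq_ptime _ _ _ _
  (fun a => flatten [seq (if p a x then [:: x] else [::]) | x <- l a])).
  by move=> a; elim: (l a) => //= x s ->; case: (p a x).
apply: (ptime_comp (@ptime_flatten _ _)).
apply: ptime_map => //; refine (ptime_if (c := fun z => p z.1 z.2) pp _ _); pt.
Qed.

Lemma ptime_negb : ptime negb.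
Proof. by apply: (@eq_ptime _ _ _ _ (fun b => if b then false else true)) => //; pt. Qed.
#[global] Hint Resolve ptime_negb : ptime.

Lemma ptime_andb : ptime (fun p : bool * bool => p.1 && p.2).
Proof. by apply: (@eq_ptime _ _ _ _ (fun p => if p.1 then p.2 else false)) => //; pt. Qed.

Lemma ptime_orb : ptime (fun p : bool * bool => p.1 || p.2).
Proof. by apply: (@eq_ptime _ _ _ _ (fun p => if p.1 then true else p.2)) => //; pt. Qed.

Lemma ptime_implb : ptime (fun p : bool * bool => p.1 ==> p.2).
Proof. by apply: (@eq_ptime _ _ _ _ (fun p => if p.1 then p.2 else true)) => //; pt. Qed.
#[global] Hint Resolve ptime_andb ptime_orb ptime_implb : ptime.

Lemma ptime_all A X {EA : Enc A} {EX : Enc X} (p : A -> X -> bool) l :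
  ptime (fun z : A * X => p z.1 z.2) -> ptime l ->
  ptime (fun a => all (p a) (l a)).
Proof.
move=> pp pl; apply: (@eq_ptime _ _ _ _ (fun a => nilp [seq x <- l a | ~~ p a x])).
  by move=> a; elim: (l a) => //= x s <-; case: (p a x).
by apply: ptime_nilp; apply: ptime_filter => //; exact: ptime_comp ptime_negb pp.
Qed.

Lemma ptime_has A X {EA : Enc A} {EX : Enc X} (p : A -> X -> bool) l :
  ptime (fun z : A * X => p z.1 z.2) -> ptime l ->
  ptime (fun a => has (p a) (l a)).
Proof.
move=> pp pl; apply: (@eq_ptime _ _ _ _ (fun a => ~~ nilp [seq x <- l a | p a x])).
  by move=> a; elim: (l a) => //= x s <-; case: (p a x).
by apply: (ptime_comp ptime_negb); apply: ptime_nilp; apply: ptime_filter.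
Qed.

Lemma ptime_eq_op A (T : eqType) {EA : Enc A} {ET : Enc T} (f g : A -> T) :
  ptime (fun p : T * T => p.1 == p.2) -> ptime f -> ptime g ->
  ptime (fun a => f a == g a).
Proof. by move=> pT pf pg; exact: ptime_comp pT (ptime_pair pf pg). Qed.

Ltac pt_eq := assumption.

Ltac pt_binder ::= lazymatch goal with
  | |- ptime (fun a => @eq_op ?T (@?f a) (@?g a)) =>
      refine (ptime_eq_op (T := T) (f := f) (g := g) _ _ _); [pt_eq | |]
  | |- ptime (fun a => all (@?p a) (@?l a)) => refine (ptime_all (p := p) (l := l) _ _)
  | |- ptime (fun a => has (@?p a) (@?l a)) => refine (ptime_has (p := p) (l := l) _ _)
  | |- ptime (fun a => map (@?p a) (@?l a)) => refine (ptime_map (f := p) (l := l) _ _)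
  | |- ptime (fun a => filter (@?p a) (@?l a)) =>
      refine (ptime_filter (p := p) (l := l) _ _)
  | |- ptime (fun a => nilp (@?l a)) => refine (ptime_nilp (g := l) _)
  end.

(** * Unary arithmetic, equality tests and maxima *)

Definition units n : seq unit := nseq n tt.

Lemma size_units n : size (units n) = n.
Proof. exact: size_nseq. Qed.

Lemma take_units i n : take i (units n) = units (minn i n).
Proof.
rewrite /units; elim: i n => [|i IH] [|n] //; rewrite minnSS /= ?IH //.
Qed.

(** A unary numeral and a list of units are the same tree, so arithmetic reduces to list
    operations. *)
Lemma enc_units n : enc (units n) = enc n.
Proof. by rewrite /units; elim: n => //= n IH; rewrite enc_cons IH. Qed.

Lemma ptime_units : ptime units.
Proof. by apply: ptime_recode => n; rewrite enc_units. Qed.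
#[global] Hint Resolve ptime_units : ptime.

Lemma ptime_size_unit : ptime (fun s : seq unit => size s).
Proof.
apply: ptime_recode => s; rewrite -enc_units; congr enc.
by rewrite /units; elim: s => //= -[] s ->.
Qed.

Lemma ptime_seqsize A {EA : Enc A} : ptime (@size A).
Proof.
apply: (@eq_ptime _ _ _ _ (fun l => size [seq tt | _ <- l])).
  by move=> l; rewrite size_map.
apply: (ptime_comp ptime_size_unit).
by apply: (@ptime_map _ _ _ _ _ _ (fun _ _ => tt) id); pt.
Qed.
#[global] Hint Resolve ptime_seqsize : ptime.

Lemma ptime_succn : ptime succn.
Proof.
apply: (@eq_ptime _ _ _ _ (fun n => size (tt :: nseq n tt))).
  by move=> n /=; rewrite size_units.
by pt.
Qed.
#[global] Hint Resolve ptime_succn : ptime.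

Lemma ptime_addn : ptime (fun p : nat * nat => p.1 + p.2).
Proof.
apply: (@eq_ptime _ _ _ _ (fun p => size (units p.1 ++ units p.2))).
  by move=> n /=; rewrite size_cat !size_units.
by pt.
Qed.

Lemma ptime_muln : ptime (fun p : nat * nat => p.1 * p.2).
Proof.
apply: (@eq_ptime _ _ _ _
  (fun p => size (flatten [seq units p.2 | _ <- units p.1]))).
  move=> [m n] /=; rewrite size_flatten /shape -map_comp.
  by rewrite /units; elim: m => //= m ->; rewrite size_nseq.
apply: (ptime_comp (@ptime_seqsize _ _)); apply: (ptime_comp (@ptime_flatten _ _)).
by apply: (@ptime_map _ _ _ _ _ _ (fun p _ => units p.2)); pt.
Qed.
#[global] Hint Resolve ptime_addn ptime_muln : ptime.

Lemma ptime_behead_seq A {EA : Enc A} : ptime (@behead A).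
Proof. exact: ptime_behead ptime_id. Qed.
Lemma ptime_head_seq A {EA : Enc A} (x0 : A) : ptime (head x0).
Proof. exact: ptime_head ptime_id. Qed.
#[global] Hint Resolve ptime_behead_seq ptime_head_seq : ptime.

Lemma ptime_drop A {EA : Enc A} : ptime (fun p : nat * seq A => drop p.1 p.2).
Proof.
have E (l : seq A) n : foldl (fun s (_ : unit) => behead s) l (units n) = drop n l.
  by rewrite /units; elim: n l => [|n IH] l; rewrite ?drop0 //= IH -drop1 drop_drop addn1.
apply: (@eq_ptime _ _ _ _
  (fun p => foldl (fun s _ => behead s) p.2 (units p.1))) => [p|]; first exact: E.
apply: (@ptime_foldl _ _ _ _ _ _ (fun _ s _ => behead s)); try by pt.
exists (fun p => sz p); first exact: pb_sz.
move=> [n l] i /=; rewrite take_units E.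
have le : dsize (enc (drop (minn i n) l)) <= dsize (enc l).
  by rewrite !dsize_enc_seq -{2}(cat_take_drop (minn i n) l) big_cat /= ltnS leq_addl.
by apply: leq_trans le _; rewrite /sz enc_pair dsize_Node /=; lia.
Qed.
#[global] Hint Resolve ptime_drop : ptime.

Lemma ptime_nth A {EA : Enc A} (x0 : A) : ptime (fun p : seq A * nat => nth x0 p.1 p.2).
Proof.
apply: (@eq_ptime _ _ _ _ (fun p => head x0 (drop p.2 p.1))); last by pt.
by move=> p; rewrite -nth0 nth_drop addn0.
Qed.
#[global] Hint Resolve ptime_nth : ptime.

Lemma ptime_subn : ptime (fun p : nat * nat => p.1 - p.2).
Proof.
apply: (@eq_ptime _ _ _ _ (fun p => size (drop p.2 (units p.1)))); last by pt.
by move=> p; rewrite size_drop size_units.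
Qed.
#[global] Hint Resolve ptime_subn : ptime.

Lemma ptime_leq : ptime (fun p : nat * nat => p.1 <= p.2).
Proof.
apply: (@eq_ptime _ _ _ _ (fun p => nilp (units (p.1 - p.2)))).
  by move=> p; rewrite /nilp size_units.
by apply: ptime_nilp; pt.
Qed.
#[global] Hint Resolve ptime_leq : ptime.

Lemma ptime_eqn : ptime (fun p : nat * nat => p.1 == p.2).
Proof.
apply: (@eq_ptime _ _ _ _ (fun p => (p.1 <= p.2) && (p.2 <= p.1))); last by pt.
by move=> p; rewrite eqn_leq.
Qed.

Lemma ptime_eqb : ptime (fun p : bool * bool => p.1 == p.2).
Proof.
apply: (@eq_ptime _ _ _ _ (fun p => if p.1 then p.2 else ~~ p.2)); last by pt.
by move=> [[] []].
Qed.

Lemma ptime_eq_pair (A B : eqType) {EA : Enc A} {EB : Enc B} :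
  ptime (fun p : A * A => p.1 == p.2) -> ptime (fun p : B * B => p.1 == p.2) ->
  ptime (fun p : (A * B) * (A * B) => p.1 == p.2).
Proof.
move=> pA pB; apply: (@eq_ptime _ _ _ _
  (fun p => (p.1.1 == p.2.1) && (p.1.2 == p.2.2))); last by pt.
by move=> [[a b] [a' b']]; rewrite [RHS]xpair_eqE.
Qed.

Lemma dsize_enc_nat n : dsize (enc n) = n.*2.+1.
Proof. by elim: n => // n IH; rewrite -[enc _]/(Node Leaf (enc n)) dsize_Node IH. Qed.

Lemma ptime_iota : ptime (iota 0).
Proof.
have E i : foldl (fun s (_ : unit) => rcons s (size s)) [::] (units i) = iota 0 i.
  (* The start [0] is read as the length of the accumulator, which makes the claim general enough
     for the induction. *)
  rewrite -[in RHS](cat0s (iota 0 i)) -[in iota 0 _](_ : size (Nil nat) = 0) //.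
  rewrite /units; elim: i [::] => [|i IH] s /=; first by rewrite cats0.
  by rewrite IH size_rcons cat_rcons.
apply: (@eq_ptime _ _ _ _
  (fun n => foldl (fun s _ => s ++ [:: size s]) [::] (units n))).
  by move=> n; rewrite -[RHS]E; apply: eq_foldl => s t; rewrite cats1.
apply: (@ptime_foldl _ _ _ _ _ _ (fun _ s _ => s ++ [:: size s]) (fun=> [::])); try by pt.
exists (fun n => (sz n) * (sz n + sz n) + 1).
  have ? : pbounded (@sz nat _) by exact: pb_sz.
  by pb.
move=> n i; rewrite take_units.
rewrite (eq_foldl (g := fun s _ => rcons s (size s))); last by move=> s t; rewrite cats1.
rewrite E dsize_enc_seq addn1 ltnS.
have szn j : sz j = j.*2.+2 by rewrite /sz dsize_enc_nat.
apply: (@leq_trans (\sum_(x <- iota 0 (minn i n)) (sz n + sz n))).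
  rewrite !big_seq; apply: leq_sum => x; rewrite mem_iota => /andP[_ H].
  by rewrite !szn; lia.
rewrite big_const_seq iter_addn_0 count_predT size_iota mulnC leq_mul2r szn; lia.
Qed.
#[global] Hint Resolve ptime_iota : ptime.

Ltac pt_eq ::= first [exact ptime_eqn | exact ptime_eqb | assumption |
  refine (ptime_eq_pair _ _); pt_eq].

Lemma ptime_eq_seq (A : eqType) {EA : Enc A} (x0 : A) :
  ptime (fun p : A * A => p.1 == p.2) ->
  ptime (fun p : seq A * seq A => p.1 == p.2).
Proof.
move=> pA; apply: (@eq_ptime _ _ _ _ (fun p => (size p.1 == size p.2) &&
    all (fun i => nth x0 p.1 i == nth x0 p.2 i) (iota 0 (size p.1)))).
  move=> [s t] /=; apply/andP/eqP => [[/eqP st /allP eq_st] | ->]; last first.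
    by split=> //; apply/allP.
  apply: (@eq_from_nth _ x0) => // i lt_i.
  by apply/eqP; apply: eq_st; rewrite mem_iota.
by pt.
Qed.

Ltac pt_eq ::= first [exact ptime_eqn | exact ptime_eqb | assumption |
  refine (ptime_eq_pair _ _); pt_eq | refine (ptime_eq_seq 0 _); pt_eq |
  refine (ptime_eq_seq (0, false) _); pt_eq ].

Lemma ptime_maxn : ptime (fun p : nat * nat => maxn p.1 p.2).
Proof. by rewrite /maxn; pt. Qed.
#[global] Hint Resolve ptime_maxn : ptime.

Lemma ptime_last A {EA : Enc A} (x0 : A) : ptime (last x0).
Proof.
apply: (@eq_ptime _ _ _ _ (fun l => head x0 (rev l))); last by pt.
by case/lastP => // l x; rewrite last_rcons rev_rcons.
Qed.
#[global] Hint Resolve ptime_last : ptime.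

Lemma ptime_bigmax : ptime (fun s : seq nat => \max_(i <- s) i).
Proof.
have E s m : foldl maxn m s = maxn m (\max_(i <- s) i).
  by elim: s m => [|x s IH] m; rewrite ?big_nil ?maxn0 // big_cons /= IH maxnA.
apply: (@eq_ptime _ _ _ _ (fun s => foldl maxn 0 s)) => [s|]; first by rewrite E max0n.
apply: (@ptime_foldl _ _ _ _ _ _ (fun _ m x => maxn m x) (fun=> 0) id); try by pt.
exists (fun s => sz s); first exact: pb_sz.
move=> s i; rewrite E max0n dsize_enc_nat; apply: leq_trans (_ : sz (take i s) <= _).
  elim: (take i s) => [|x s' IH]; rewrite ?big_nil // big_cons.
  move: IH; rewrite /sz enc_cons dsize_Node dsize_enc_nat; lia.
by rewrite ltnS dsize_take.
Qed.
#[global] Hint Resolve ptime_bigmax : ptime.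

(** * Circuits of weft 1 *)

Section Sweep.
Variables (T : Type) (h : seq T -> gate -> T).

Lemma sweep_rcons C g : sweep h (rcons C g) = rcons (sweep h C) (h (sweep h C) g).
Proof. by rewrite /sweep -cats1 foldl_cat. Qed.

Lemma size_sweep C : size (sweep h C) = size C.
Proof. by elim/last_ind: C => // C g IH; rewrite sweep_rcons !size_rcons IH. Qed.

Lemma take_sweep i C : take i (sweep h C) = sweep h (take i C).
Proof.
elim/last_ind: C => // C g IH; rewrite sweep_rcons.
case: (leqP i (size C)) => le_i.
  by rewrite -!cats1 !takel_cat ?size_sweep.
by rewrite !take_oversize ?size_rcons ?size_sweep // sweep_rcons.
Qed.

Lemma nth_sweep x0 C i : i < size C ->
  nth x0 (sweep h C) i = h (take i (sweep h C)) (nth Input C i).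
Proof.
elim/last_ind: C => // C g IH; rewrite size_rcons ltnS sweep_rcons => le_i.
rewrite !nth_rcons size_sweep; case: ltngtP le_i => // [lt_i _ | -> _].
  by rewrite IH // -cats1 takel_cat // size_sweep ltnW.
by rewrite -cats1 take_cat size_sweep ltnn subnn take0 cats0.
Qed.

End Sweep.

(** * Provable values of circuit nodes *)

Definition sel (b : bool) (x : bool * bool) : bool := if b then x.1 else x.2.

(** Proof search in a circuit: the first component of a node says that its
    value is provably true, the second one that it is provably false, where
    [o] lists the facts that are taken as axioms. *)
Definition gate_prov (o vs : seq (bool * bool)) (g : gate) : bool * bool :=
  let v b j := sel b (nth (false, false) vs j) in
  let x := nth (false, false) o (size vs) in
  match g with
  | Input => x
  | Not j => (x.1 || v false j, x.2 || v true j)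
  | And js => (x.1 || all (v true) js, x.2 || has (v false) js)
  | Or js => (x.1 || has (v true) js, x.2 || all (v false) js)
  end.

Section Circuit.
Variable C : circuit.
Hypothesis okC : circuit_ok C.

Let n := size C.
Notation gt i := (nth Input C i).

Definition nval a i := nth false (sweep (gate_value a) C) i.
Definition nweft i := nth 0 (sweep gate_weft C) i.
Definition ndepth i := nth 0 (sweep gate_depth C) i.
Definition ax (o : seq (bool * bool)) i b := sel b (nth (false, false) o i).
Definition prov o i b := ax (sweep (gate_prov o) C) i b.

Arguments ax : simpl never.
Arguments prov : simpl never.

Lemma pred_lt i j : i < n -> j \in preds (gt i) -> j < i.
Proof.
by move=> lt_i; case/and3P: okC => _ _ /allP/(_ i); rewrite mem_iota => /(_ lt_i)/allP; apply.
Qed.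

Lemma pred_ltn i j : i < n -> j \in preds (gt i) -> j < n.
Proof. by move=> lt_i /(pred_lt lt_i)/ltn_trans; apply. Qed.

Lemma nth_take_pred T (x0 : T) (s : seq T) i j : i < n -> j \in preds (gt i) ->
  nth x0 (take i s) j = nth x0 s j.
Proof. by move=> lt_i /(pred_lt lt_i) lt_j; rewrite nth_take. Qed.

Lemma nvalE a i : i < n -> nval a i =
  match gt i with
  | Input => a i
  | Not j => ~~ nval a j
  | And js => all (nval a) js
  | Or js => has (nval a) js
  end.
Proof.
move=> lt_i; rewrite /nval nth_sweep // /gate_value.
have H := nth_take_pred false (sweep (gate_value a) C) lt_i.
case: (gt i) H => [_|j H|js H|js H] /=.
- by rewrite size_takel // size_sweep ltnW.
- by rewrite H ?mem_seq1.
- exact: eq_in_all.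
- exact: eq_in_has.
Qed.

Lemma nweft_pred i j : i < n -> j \in preds (gt i) -> nweft j + large (gt i) <= nweft i.
Proof.
move=> lt_i j_i; rewrite {2}/nweft nth_sweep // /gate_weft addnC leq_add2l.
by rewrite (big_rem j) //= leq_max nth_take_pred // /nweft leqnn.
Qed.

Lemma ndepth_pred i j : i < n -> j \in preds (gt i) -> ndepth j < ndepth i.
Proof.
move=> lt_i j_i; rewrite {2}/ndepth nth_sweep // /gate_depth.
case: ifP => [|_]; first by case: (gt i) j_i.
by rewrite ltnS (big_rem j) //= leq_max nth_take_pred // /ndepth leqnn.
Qed.

Lemma provE o i b : i < n -> prov o i b = ax o i b ||
  match gt i with
  | Input => false
  | Not j => prov o j (~~ b)
  | And js => if b then all (prov o ^~ true) js else has (prov o ^~ false) js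
  | Or js => if b then has (prov o ^~ true) js else all (prov o ^~ false) js
  end.
Proof.
move=> lt_i; rewrite /prov /ax nth_sweep //.
have H := nth_take_pred (false, false) (sweep (gate_prov o) C) lt_i.
rewrite /gate_prov; have -> : size (take i (sweep (gate_prov o) C)) = i.
  by rewrite size_takel // size_sweep ltnW.
case: (gt i) H => [_|j H|js H|js H] /=.
- by rewrite orbF.
- by rewrite H ?mem_seq1 //; case: b.
- case: b => /=; congr (_ || _).
    by apply: eq_in_all => j /H ->.
  by apply: eq_in_has => j /H ->.
- case: b => /=; congr (_ || _).
    by apply: eq_in_has => j /H ->.
  by apply: eq_in_all => j /H ->.
Qed.

(** Induction along the topological order: every rule of [gate_prov] infers a true fact from true
    facts about in-neighbours. *)
Lemma prov_sound a o :
  (forall i b, i < n -> ax o i b -> nval a i = b) ->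
  forall i b, i < n -> prov o i b -> nval a i = b.
Proof.
move=> H i; elim/ltn_ind: i => i IH b lt_i; rewrite provE // => /orP[|]; first exact: H.
have IH' j b' : j \in preds (gt i) -> prov o j b' -> nval a j = b'.
  by move=> ji; apply: IH; [apply: pred_lt ji | apply: pred_ltn ji].
rewrite nvalE //; case: (gt i) IH' => [//|j|js|js] /= IH'.
- by move=> pj; rewrite (IH' j (~~ b)) ?mem_seq1 // negbK.
- case: b => [/allP pj|/hasP[j jj pj]]; first by apply/allP => j jj; exact: (IH' j true jj (pj _ jj)).
  by apply/negbTE/allPn; exists j => //; rewrite (IH' _ _ jj pj).
- case: b => [/hasP[j jj pj]|/allP pj]; first by apply/hasP; exists j => //; exact: (IH' j true jj pj).
  by apply/negbTE/hasPn => j jj; rewrite (IH' _ _ jj (pj _ jj)).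
Qed.

Section Assignment.
Variable a : pred nat.
Notation va := (nval a).

(** Completeness of the rules at a single gate: a universal value uses all in-neighbours, an
    existential one a single witness. *)
Lemma prov_gate o i : i < n -> ~~ is_input (gt i) ->
  (forall j, j \in preds (gt i) -> prov o j (va j)) -> prov o i (va i).
Proof.
move=> lt_i; rewrite provE // nvalE //; case: (gt i) => [//|j|js|js] _ /= H.
- by rewrite negbK H ?mem_seq1 ?orbT.
- case: allP => [Hj|/allP/allPn[j jj nj]].
    by apply/orP; right; apply/allP => j jj; rewrite -(Hj _ jj) H.
  by apply/orP; right; apply/hasP; exists j => //; have := H j jj; rewrite (negbTE nj).
- case: hasP => [[j jj vj]|nj].
    by apply/orP; right; apply/hasP; exists j => //; have := H j jj; rewrite vj.
  apply/orP; right; apply/allP => j jj; have := H j jj.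
  by case vj: (va j) => //; case: nj; exists j.
Qed.

(** A certificate: at most [N] true facts of kind [G] from which all of [X] becomes provable. Since
    this is asked of every table [o] that contains the facts, certificates for several goals can be
    concatenated. *)
Definition proof_by (G : nat -> bool -> Prop) (N : nat) (X : nat -> bool -> Prop) :=
  exists F : seq (nat * bool), [/\ size F <= N,
    forall f, f \in F -> [/\ f.1 < n, f.2 = va f.1 & G f.1 f.2]
    & forall o, (forall f, f \in F -> ax o f.1 f.2) ->
        forall i b, X i b -> prov o i b].

Lemma proof_by_seq G N js :
  (forall j, j \in js -> proof_by G N (fun i b => i = j /\ b = va j)) ->
  proof_by G (size js * N) (fun i b => i \in js /\ b = va i).
Proof.
elim: js => [|j js IH] H; first by exists [::]; split=> // o _ i b [].
have [|F [szF gF pF]] := IH; first by move=> j' j'j; apply: H; rewrite inE j'j orbT.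
have [|F' [szF' gF' pF']] := H j; first by rewrite mem_head.
exists (F' ++ F); split.
- by rewrite size_cat /= mulSn leq_add.
- by move=> f; rewrite mem_cat => /orP[/gF'|/gF].
- move=> o Ho i b [+ ->]; rewrite inE => /orP[/eqP->|ij].
    by apply: (pF' o) => // f fF; apply: Ho; rewrite mem_cat fF.
  by apply: (pF o) => // f fF; apply: Ho; rewrite mem_cat fF orbT.
Qed.

Lemma gate_okC i : i < n -> gate_ok (gt i).
Proof. by move=> lt_i; case/and3P: okC => _ /all_nthP H _; apply: H. Qed.

Lemma proof_by_fact G i : i < n -> G i (va i) ->
  proof_by G 1 (fun i' b => i' = i /\ b = va i).
Proof.
move=> lt_i Gi; exists [:: (i, va i)]; split=> // [f|o Ho _ _ [-> ->]].
  by rewrite mem_seq1 => /eqP->.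
by rewrite provE //; have /= -> := Ho _ (mem_head _ _).
Qed.

(** A gate that is not large has at most two in-neighbours, so one level at most doubles the
    certificate. This is where the powers of 2 come from. *)
Lemma proof_by_small G r i : i < n -> ~~ is_input (gt i) -> ~~ large (gt i) ->
  (forall j, j \in preds (gt i) -> proof_by G (2 ^ r) (fun i b => i = j /\ b = va j)) ->
  proof_by G (2 ^ r.+1) (fun i' b => i' = i /\ b = va i).
Proof.
move=> lt_i ninp sm /proof_by_seq[F [szF gF pF]]; exists F; split=> //.
  apply: leq_trans szF _; rewrite expnS leq_mul2r.
  by move: sm; rewrite /large -leqNgt => ->; rewrite orbT.
by move=> o Ho _ _ [-> ->]; apply: prov_gate => // j ji; apply: (pF o Ho).
Qed.

Lemma proof_by_le G N N' X : N <= N' -> proof_by G N X -> proof_by G N' X.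
Proof. by move=> le [F [sz g p]]; exists F; split=> //; apply: leq_trans le. Qed.

(** At weft 0 no gate on the way down is large, so unfolding to the inputs doubles the number of
    facts once per level. *)
Lemma proof_by_weft0 (G : nat -> bool -> Prop) r i :
  (forall j, j < n -> is_input (gt j) -> G j (va j)) ->
  i < n -> nweft i = 0 -> ndepth i <= r ->
  proof_by G (2 ^ r) (fun i' b => i' = i /\ b = va i).
Proof.
move=> HG; elim: r i => [|r IH] i lt_i w0 dr; case inp: (is_input (gt i)).
- by apply: proof_by_fact => //; apply: HG.
- have : preds (gt i) != [::].
    by have := gate_okC lt_i; case: (gt i) inp => [//|j|[|? ?]|[|? ?]] //=; rewrite andbF.
  case E: (preds (gt i)) => [//|j js] _.
  by have := @ndepth_pred i j lt_i; rewrite E mem_head => /(_ isT); lia.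
- by apply: proof_by_le (proof_by_fact _ _) => //; rewrite ?expn_gt0 //; apply: HG.
- apply: proof_by_small => //; first by rewrite inp.
    (* A large gate has an in-neighbour, and [nweft_pred] then makes its weft positive. *)
    apply/negP => lg.
    have : preds (gt i) != [::] by move: lg; rewrite /large; case: (preds _).
    case E: (preds (gt i)) => [//|j js] _.
    by have := @nweft_pred i j lt_i; rewrite E mem_head lg w0 => /(_ isT); lia.
  move=> j ji; apply: IH; first exact: pred_ltn ji.
    by have := nweft_pred lt_i ji; lia.
  by have := ndepth_pred lt_i ji; lia.
Qed.

Definition easy d j := (nweft j == 0) && (ndepth j <= d).

(** A false fact of this kind is refuted by boundedly many inputs. *)
Definition allowed d i b :=
  match gt i with
  | Input => true
  | Not _ => false
  | And js => b && all (easy d) js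
  | Or js => ~~ b && all (easy d) js
  end.

Lemma allowed_input d i b : is_input (gt i) -> allowed d i b.
Proof. by rewrite /allowed; case: (gt i). Qed.

(** Small gates are unfolded as before. The in-neighbours of a large gate have weft 0: if the value
    of the gate is universal, it is itself an allowed fact; otherwise one in-neighbour decides it
    and is proved from inputs. *)
Lemma proof_by_weft1 d r i : r <= d -> i < n -> nweft i <= 1 -> ndepth i <= r ->
  proof_by (fun i b => allowed d i b) (2 ^ r) (fun i' b => i' = i /\ b = va i).
Proof.
elim: r i => [|r IH] i rd lt_i w1 dr.
  apply: (@proof_by_weft0 _ 0) => //.
    by move=> j _; apply: allowed_input.
  have : is_input (gt i).
    case inp: (is_input (gt i)) => //.
    have : preds (gt i) != [::].
      by have := gate_okC lt_i; case: (gt i) inp => [//|j|[|? ?]|[|? ?]] //=; rewrite andbF.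
    case E: (preds (gt i)) => [//|j js] _.
    by have := @ndepth_pred i j lt_i; rewrite E mem_head => /(_ isT); lia.
  by rewrite /nweft nth_sweep // /gate_weft /large; case: (gt i) => //= _; rewrite big_nil.
case lg: (large (gt i)); last first.
  case inp: (is_input (gt i)).
    by apply: proof_by_le (proof_by_fact _ _) => //; rewrite ?expn_gt0 //; apply: allowed_input.
  apply: proof_by_small; rewrite ?inp ?lg // => j ji; apply: IH.
  - by lia.
  - exact: pred_ltn ji.
  - by have := nweft_pred lt_i ji; lia.
  - by have := ndepth_pred lt_i ji; lia.
have ez j : j \in preds (gt i) -> [/\ j < n, nweft j = 0 & ndepth j <= r].
  move=> ji; split; first exact: pred_ltn ji.
    by have := nweft_pred lt_i ji; rewrite lg; lia.
  by have := ndepth_pred lt_i ji; lia.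
have ezd js : preds (gt i) = js -> all (easy d) js.
  move=> E; apply/allP => j; rewrite -E => /ez[_ w0 dj]; rewrite /easy w0 /=; lia.
have wit j : j \in preds (gt i) ->
   proof_by (fun i b => allowed d i b) (2 ^ r.+1) (fun i' b => i' = j /\ b = va j).
  move=> /ez[lt_j wj dj]; apply: (@proof_by_weft0 _ r.+1) => //.
    by move=> u _; apply: allowed_input.
  exact: leqW.
case E: (gt i) lg ez ezd wit => [//|//|js|js] _ /= ez ezd wit.
- case vi: (va i).
    rewrite -vi; apply: proof_by_le (proof_by_fact _ _) => //; first by rewrite expn_gt0.
    by rewrite /allowed E vi ezd.
  have := vi; rewrite nvalE // E => /negbT/allPn[j jj nj].
  have [F [szF gF pF]] := wit j jj; exists F; split=> // o Ho _ _ [-> ->].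
  rewrite provE // E; apply/orP; right; apply/hasP; exists j => //.
  by apply: (pF o Ho); rewrite (negbTE nj).
- case vi: (va i); last first.
    rewrite -vi; apply: proof_by_le (proof_by_fact _ _) => //; first by rewrite expn_gt0.
    by rewrite /allowed E vi ezd.
  have := vi; rewrite nvalE // E => /hasP[j jj nj].
  have [F [szF gF pF]] := wit j jj; exists F; split=> // o Ho _ _ [-> ->].
  rewrite provE // E; apply/orP; right; apply/hasP; exists j => //.
  by apply: (pF o Ho).
Qed.

(** A universal claim about a gate fails at a single in-neighbour. That node has weft 0 and depth at
    most [d], so at most [2 ^ d] inputs determine its value. *)
Lemma allowed_refutable d i b : i < n -> allowed d i b -> va i = ~~ b ->
  proof_by (fun j _ => is_input (gt j)) (2 ^ d) (fun i' b' => i' = i /\ b' = ~~ b).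
Proof.
move=> lt_i al vi.
have wit j : j \in preds (gt i) -> easy d j ->
    proof_by (fun j _ => is_input (gt j)) (2 ^ d) (fun i' b => i' = j /\ b = va j).
  move=> ji /andP[/eqP w0 dj]; apply: proof_by_weft0 => //.
  exact: pred_ltn ji.
move: al; rewrite /allowed; case E: (gt i) wit => [|//|js|js] /= wit.
- move=> _; rewrite -vi; apply: proof_by_le (proof_by_fact _ _) => //.
    by rewrite expn_gt0.
  by rewrite E.
- case/andP=> bT /allP ez; move: vi; rewrite bT nvalE // E => /negbT/allPn[j jj nj].
  have [F [szF gF pF]] := wit j jj (ez j jj); exists F; split=> // o Ho _ _ [-> ->].
  rewrite provE // E; apply/orP; right; apply/hasP; exists j => //.
  by apply: (pF o Ho); rewrite (negbTE nj).
- case/andP=> bF /allP ez; move: vi; rewrite bF nvalE // E => /hasP[j jj nj].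
  have [F [szF gF pF]] := wit j jj (ez j jj); exists F; split=> // o Ho _ _ [-> ->].
  rewrite provE // E; apply/orP; right; apply/hasP; exists j => //.
  by apply: (pF o Ho).
Qed.

End Assignment.
End Circuit.

(** * Local views *)

Fixpoint allseq T m (l : seq T) : seq (seq T) :=
  if m is m'.+1 then [seq x :: s | x <- l, s <- allseq m' l] else [:: [::]].

Lemma mem_allseq (T : eqType) m (l : seq T) s :
  (s \in allseq m l) = (size s == m) && all (fun x => x \in l) s.
Proof.
elim: m s => [|m IH] s /=; first by rewrite mem_seq1; case: s.
apply/allpairsP/idP => [[[x t] /= [xl tl ->]]|].
  by move: tl; rewrite IH /= xl eqSS.
case: s => // x s /=; rewrite eqSS => /and3P[sz xl al].
by exists (x, s); rewrite IH sz al.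
Qed.

Lemma uniq_allseq (T : eqType) m (l : seq T) : uniq l -> uniq (allseq m l).
Proof.
move=> ul; elim: m => //= m IH.
by apply: allpairs_uniq => // -[x s] [y t] _ _ [-> ->].
Qed.

(** A view: its cells, and the facts that it claims. *)
Definition descr : Type := (seq (nat * nat) * seq (nat * bool))%type.

Definition slot (u : descr) : seq nat := unzip1 u.1.

(** A cell [(i, p)] says that the [i]-th true input is the node [p - 1], where
    [p = 0] and [p = size C + 1] are the sentinels for [i = 0] and [i = k + 1]. *)
Definition cell_ok (C : circuit) k (c : nat * nat) : bool :=
  if c.1 == 0 then c.2 == 0
  else if c.1 == k.+1 then c.2 == (size C).+1
  else [&& 0 < c.2, c.2 <= size C & is_input (nth Input C c.2.-1)].

(** Demanded in both directions, this also forces equal positions at equal indices, so that the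
    cells of all chosen views come from one increasing function. *)
Definition mono (cs cs' : seq (nat * nat)) : bool :=
  all (fun c => all (fun c' => (c.1 <= c'.1) == (c.2 <= c'.2)) cs') cs.

(** The input facts that the cells certify. Node [i] appears as [i.+1] because cells number the
    nodes from 1. *)
Definition ax_cells (C : circuit) (cs : seq (nat * nat)) : seq (bool * bool) :=
  [seq (is_input (nth Input C i) && has (fun c => c.2 == i.+1) cs,
        is_input (nth Input C i) && has (fun c => has (fun c' =>
          (c'.1 == c.1.+1) && ((c.2 < i.+1) && (i.+1 < c'.2))) cs) cs)
    | i <- iota 0 (size C)].

Definition ax_facts (C : circuit) (w : seq (nat * bool)) : seq (bool * bool) :=
  [seq (has (fun f => f == (i, true)) w, has (fun f => f == (i, false)) w)
    | i <- iota 0 (size C)].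

Definition proofs (C : circuit) o := sweep (gate_prov o) C.

Definition unrefuted (vs : seq (bool * bool)) (f : nat * bool) : bool :=
  ~~ sel (~~ f.2) (nth (false, false) vs f.1).

Definition valid (C : circuit) d k (u : descr) : bool :=
  all (cell_ok C k) u.1 && (mono u.1 u.1 &&
  (all (fun f => (f.1 < size C) ==> allowed C d f.1 f.2) u.2 &&
  (sel true (last (false, false) (proofs C (ax_facts C u.2))) &&
  all (unrefuted (proofs C (ax_cells C u.1))) u.2))).

Definition compat (u v : descr) : bool :=
  (u.2 == v.2) && ((slot u != slot v) && (mono u.1 v.1 && mono v.1 u.1)).

(** The tuples have room for [2 ^ d] inputs with two cells each: a true input takes one cell, a
    false one the two cells around it. *)
Definition slots d k : seq (seq nat) := allseq (2 ^ d.+1) (iota 0 k.+2).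

(** Facts range over one position more than there are nodes; position [size C] serves for padding
    lists of facts to their fixed length. *)
Definition descrs (C : circuit) d k : seq descr :=
  [seq u <- [seq (cs, w)
    | cs <- allseq (2 ^ d.+1)
              [seq (i, p) | i <- iota 0 k.+2, p <- iota 0 (size C).+2],
      w <- allseq (2 ^ d)
              [seq (i, b) | i <- iota 0 (size C).+1, b <- [:: true; false]]]
  | valid C d k u].

(** A binary constraint satisfaction problem: the variables are the index tuples, their values are
    views. *)
Definition csp C d k : Prop := exists phi : seq nat -> descr,
  forall sg, sg \in slots d k ->
    [/\ phi sg \in descrs C d k, slot (phi sg) = sg
      & forall sg', sg' \in slots d k -> sg != sg' -> compat (phi sg) (phi sg')].

Lemma compatC u v : compat u v = compat v u.
Proof.
by rewrite /compat (eq_sym u.2) (eq_sym (slot u)); do 2!congr (_ && _); rewrite andbC.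
Qed.

Lemma compatxx u : compat u u = false.
Proof. by rewrite /compat !eqxx. Qed.

Lemma monoP cs cs' : reflect (forall i p i' p', (i, p) \in cs -> (i', p') \in cs' ->
  (i <= i') = (p <= p')) (mono cs cs').
Proof.
apply: (iffP allP) => [H i p i' p' /H/allP H' /H'/eqP// | H [i p] cin].
by apply/allP => -[i' p'] cin' /=; rewrite (H _ _ _ _ cin cin').
Qed.

(** * Increasing enumerations of the true inputs *)

Section Rank.
Variables (C : circuit) (d k : nat).
Hypothesis okC : circuit_ok C.
Let n := size C.
Notation gt i := (nth Input C i).

Variable s : nat -> nat.
Hypotheses (s0 : s 0 = 0) (sk : s k.+1 = n.+1).
Hypothesis smono : forall i j, i <= k.+1 -> j <= k.+1 -> (i <= j) = (s i <= s j).
Hypothesis sinp : forall i, 0 < i <= k -> is_input (gt (s i).-1).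

(** The assignment enumerated by [s], without the sentinels; positions are shifted by one. *)
Definition rank_set : pred nat := fun p => has (fun i => s i == p.+1) (iota 1 k).

Lemma s_lt i j : i <= k.+1 -> j <= k.+1 -> (i < j) = (s i < s j).
Proof. by move=> ik jk; rewrite !ltnNge smono. Qed.

Lemma s_range i : 0 < i <= k -> 0 < s i <= n.
Proof.
clear okC; move=> /andP[i0 ik]; rewrite -{1}s0 -s_lt ?i0 //=; last lia.
by rewrite -ltnS -sk -s_lt //; lia.
Qed.

(** Admitting the sentinel indices changes nothing, as their values [0] and [n.+1] differ from
    [p.+1] for every node [p]. *)
Lemma rank_setP p : p < n -> reflect (exists2 i, i <= k.+1 & s i = p.+1) (rank_set p).
Proof.
move=> lt_p; apply: (iffP hasP) => [[i]|[i ik si]].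
  by rewrite mem_iota => ik /eqP si; exists i => //; lia.
exists i; last exact/eqP.
rewrite mem_iota; have i0 : i != 0 by apply/eqP => i0; move: si; rewrite i0 s0.
have ik1 : i != k.+1.
  by apply/eqP => ik1; move: si; rewrite ik1 sk /n => -[E]; rewrite -E ltnn in lt_p.
by lia.
Qed.

Lemma ax_cellsE cs i b : i < n -> ax (ax_cells C cs) i b = is_input (gt i) &&
  if b then has (fun c => c.2 == i.+1) cs
  else has (fun c => has (fun c' =>
          (c'.1 == c.1.+1) && ((c.2 < i.+1) && (i.+1 < c'.2))) cs) cs.
Proof.
move=> lt_i; rewrite /ax /ax_cells (nth_map 0) ?size_iota // nth_iota // add0n.
by case: b.
Qed.

Lemma ax_factsE w i b : i < n -> ax (ax_facts C w) i b = ((i, b) \in w).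
Proof.
move=> lt_i; rewrite /ax /ax_facts (nth_map 0) ?size_iota // nth_iota // add0n.
by case: b; rewrite /= has_pred1.
Qed.

Definition good_cells (cs : seq (nat * nat)) := forall i p, (i, p) \in cs -> i <= k.+1 /\ p = s i.

(** No value of the increasing [s] lies strictly between two consecutive ones, so an input certified
    as false is not enumerated. *)
Lemma ax_cells_sound cs i b : good_cells cs -> i < n -> ax (ax_cells C cs) i b ->
  nval C rank_set i = b.
Proof.
move=> gcs lt_i; rewrite ax_cellsE // nvalE // => /andP[inp].
case: (gt i) inp => // _; case: b.
  case/hasP=> -[j p] /gcs[jk ->] /= /eqP sj.
  by apply/rank_setP => //; exists j.
case/hasP=> -[j p] /gcs[jk ->] /hasP[[j' p'] /gcs[jk' ->]] /=.
case/andP=> /eqP E /andP[lt1 lt2]; apply/negbTE/rank_setP => // -[h hk sh].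
move: lt1 lt2; rewrite -sh -!s_lt // E; lia.
Qed.

(** A true input is certified by its own cell, taken twice; a false one by the cells of the two
    consecutive values around it. *)
Lemma cells_for u : u < n -> is_input (gt u) ->
  exists i j, [/\ i <= k.+1, j <= k.+1 & forall cs, (i, s i) \in cs -> (j, s j) \in cs ->
    ax (ax_cells C cs) u (nval C rank_set u)].
Proof.
move=> lt_u inp; have -> : nval C rank_set u = rank_set u.
  by rewrite nvalE //; case: (gt u) inp.
case: rank_setP => // [[i ik si]|nu].
  exists i, i; split=> // cs ics _; rewrite ax_cellsE // inp /=.
  by apply/hasP; exists (i, s i) => //=; rewrite si.
have [i le_i between] : exists2 i, i <= k & s i < u.+1 /\ u.+1 < s i.+1.
  have : s k.+1 > u.+1 by rewrite sk; lia.
  (* Descend from [k.+1], where [s] exceeds [u.+1], until the value drops below [u.+1]; hitting it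
     exactly would make [u] true. *)
  move: (leqnn k.+1); elim: {-2}k.+1 => [|j IH] jk; first by rewrite s0.
  move=> lt_j; case: (ltngtP (s j) u.+1) => [lt1|lt1|E].
  - by exists j => //; lia.
  - by apply: IH => //; lia.
  - by case: nu; exists j => //; lia.
exists i, i.+1; split; [lia|lia|] => cs ics jcs; rewrite ax_cellsE // inp /=.
apply/hasP; exists (i, s i) => //; apply/hasP; exists (i.+1, s i.+1) => //=.
by rewrite eqxx /=; apply/andP.
Qed.

Lemma cells_for_seq (F : seq (nat * bool)) :
  (forall f, f \in F ->
    [/\ f.1 < n, f.2 = nval C rank_set f.1 & is_input (gt f.1)]) ->
  exists sg : seq nat, [/\ size sg = 2 * size F, all (leq^~ k.+1) sg
    & forall cs, (forall i, i \in sg -> (i, s i) \in cs) ->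
        forall f, f \in F -> ax (ax_cells C cs) f.1 f.2].
Proof.
elim: F => [|f F IH] H; first by exists [::].
have [|sg [szg ag pg]] := IH; first by move=> f' f'F; apply: H; rewrite inE f'F orbT.
have [ltf vf inf] := H f (mem_head _ _).
have [i [j [ik jk Hij]]] := cells_for ltf inf.
exists [:: i, j & sg]; split; rewrite /= ?szg ?ik ?jk //; first lia.
move=> cs Hcs f'; rewrite inE => /orP[/eqP->|f'F].
  by rewrite vf; apply: Hij; apply: Hcs; rewrite !inE eqxx ?orbT.
by apply: pg => // h hg; apply: Hcs; rewrite !inE hg !orbT.
Qed.

(** All views claim the facts of one certificate of the output and take their cells from [s]. Such
    cells certify only true input facts, so they never refute a true claim. *)
Lemma csp_of_rank : nweft C n.-1 <= 1 -> ndepth C n.-1 <= d ->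
  circuit_value C rank_set -> csp C d k.
Proof.
move=> w1 dd cv.
have n0 : 0 < n by case/and3P: okC.
have lt1 : n.-1 < n by lia.
have vlast : nval C rank_set n.-1 = true.
  by move: cv; rewrite /circuit_value -nth_last size_sweep.
have [F [szF gF pF]] := proof_by_weft1 okC rank_set (leqnn d) lt1 w1 dd.
(* The padding concerns [n], which is no node: it escapes the test of [allowed], and the default
   [(false, false)] never refutes it. *)
pose w := F ++ nseq (2 ^ d - size F) (n, true).
have wF f : f \in w -> f \in F \/ f = (n, true).
  by rewrite mem_cat => /orP[|/nseqP[-> _]]; [left | right].
exists (fun sg => ([seq (i, s i) | i <- sg], w)) => sg sgin.
have slE (sg' : seq nat) : slot ([seq (i, s i) | i <- sg'], w) = sg'.
  by rewrite /slot /unzip1 -map_comp map_id.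
have gd sg' : sg' \in slots d k -> good_cells [seq (i, s i) | i <- sg'].
  rewrite mem_allseq => /andP[_ /allP al] i p /mapP[j /al + [-> ->]].
  by rewrite mem_iota => jk; split=> //; lia.
have mn sg1 sg2 : sg1 \in slots d k -> sg2 \in slots d k ->
    mono [seq (i, s i) | i <- sg1] [seq (i, s i) | i <- sg2].
  by move=> /gd g1 /gd g2; apply/monoP => i p i' p' /g1[ik ->] /g2[ik' ->]; apply: smono.
split; [| exact: slE |] => [|sg' sgin' neq]; last first.
  by rewrite /compat !slE neq /= eqxx !mn.
rewrite mem_filter; apply/andP; split; last first.
  apply/allpairsP; exists ([seq (i, s i) | i <- sg], w); split => //.
    move: (sgin); rewrite !mem_allseq size_map => /andP[-> /allP al]; rewrite andTb.
    apply/allP => _ /mapP[i /al + ->]; rewrite mem_iota => ik.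
    apply/allpairsP; exists (i, s i); rewrite !mem_iota; split=> //.
    by rewrite add0n ltnS -/n -sk -smono //; lia.
  rewrite mem_allseq size_cat size_nseq subnKC // eqxx andTb.
  apply/allP => -[i b] /wF[/gF[lt_i _ _]|[-> ->]].
    apply/allpairsP; exists (i, b); rewrite mem_iota; split=> //; last by case: (b).
    exact: ltnW.
  by apply/allpairsP; exists (n, true); rewrite mem_iota; split=> //; exact: leqnn.
rewrite /valid /=; apply/and5P; split.
- apply/allP => -[i p] /(gd _ sgin)[ik ->]; rewrite /cell_ok /=.
  case: eqP => [-> //|i0]; first by rewrite s0.
  case: eqP => [->|ik1]; first by rewrite sk.
  by rewrite andbA s_range ?sinp //; lia.
- exact: mn.
- apply/allP => -[i b] /wF[/gF[lt_i _ al]|[-> _]] /=; first by rewrite lt_i.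
  by rewrite ltnn.
- rewrite -nth_last /proofs size_sweep.
  suff : prov C (ax_facts C w) n.-1 (nval C rank_set n.-1) by rewrite vlast.
  apply: (pF (ax_facts C w)) => // f fF; have [lt_f _ _] := gF _ fF.
  by rewrite ax_factsE // -surjective_pairing mem_cat fF.
- apply/allP => f /wF[fF|->]; last by rewrite /unrefuted nth_default // size_sweep.
  have [lt_f vf _] := gF _ fF; apply/negP => bad.
  suff : nval C rank_set f.1 = ~~ f.2 by rewrite -vf; case: f.2.
  apply: (prov_sound okC _ lt_f bad) => i b; apply: ax_cells_sound; exact: gd.
Qed.

(** A false common claim would be refuted by at most [2 ^ d] inputs. Their cells fit into one index
    tuple, and the view chosen there would refute the claim. Hence all claims about nodes are true,
    and so is the output that they prove. *)
Lemma rank_of_csp (phi : seq nat -> descr) (w : seq (nat * bool)) :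
  (forall sg, sg \in slots d k -> [/\ valid C d k (phi sg), slot (phi sg) = sg,
     (phi sg).2 = w & good_cells (phi sg).1]) ->
  circuit_value C rank_set.
Proof.
move=> H; have n0 : 0 < n by case/and3P: okC.
have ltn1 : n.-1 < n by lia.
(* Short index tuples are filled up with the sentinel index [0]. *)
have pad (sg : seq nat) : size sg <= 2 ^ d.+1 -> all (leq^~ k.+1) sg ->
    exists2 sg', sg' \in slots d k & {subset sg <= sg'}.
  move=> szg /allP ag; exists (sg ++ nseq (2 ^ d.+1 - size sg) 0); last first.
    by move=> i ig; rewrite mem_cat ig.
  rewrite mem_allseq size_cat size_nseq subnKC // eqxx andTb.
  apply/allP => i; rewrite mem_cat mem_iota => /orP[/ag//|/nseqP[-> _]//].
have [sg0 sg0in _] := pad [::] isT isT.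
have [/and5P[_ _ /allP al pr _] _ w0 _] := H _ sg0in.
rewrite w0 in al pr.
have tr f : f \in w -> f.1 < n -> f.2 = nval C rank_set f.1.
  move=> fw lt_f; have := al f fw; rewrite -/n lt_f /= => alf.
  case: (eqVneq f.2 (nval C rank_set f.1)) => // neq.
  have vf : nval C rank_set f.1 = ~~ f.2 by case: f.2 (nval _ _ _) neq => [] [].
  have [F [szF gF pF]] := allowed_refutable okC lt_f alf vf.
  have [sg [szg ag Hg]] := cells_for_seq gF.
  have [||sg' sgin' sub] := pad sg => //; first by rewrite szg expnS leq_mul2l szF orbT.
  have [/and5P[_ _ _ _ /allP un] sl ww gc] := H _ sgin'.
  have /negP[] := un f (eq_rect _ (fun w => f \in w) fw _ (esym ww)).
  apply: (pF (ax_cells C (phi sg').1)) => // f' f'F; apply: (Hg _ _ _ f'F) => i /sub.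
  rewrite -{1}sl => /mapP[[j p] jp /= E]; rewrite E in jp *.
  by have [_ <-] := gc _ _ jp.
rewrite /circuit_value -nth_last size_sweep -/n.
apply: (@prov_sound C okC rank_set (ax_facts C w)) => //.
  by move=> i b lt_i; rewrite ax_factsE // => /tr /(_ lt_i).
by move: pr; rewrite -nth_last /proofs size_sweep.
Qed.
End Rank.

Definition is_rank (C : circuit) k (s : nat -> nat) : Prop :=
  [/\ s 0 = 0, s k.+1 = (size C).+1,
      forall i j, i <= k.+1 -> j <= k.+1 -> (i <= j) = (s i <= s j)
    & forall i, 0 < i <= k -> is_input (nth Input C (s i).-1)].

(** To recover an enumeration from chosen views, [s i] is read off the view of the constant tuple of
    [i]; the order conditions make all other views agree with it. *)
Lemma csp_rank C d k : circuit_ok C -> weft C <= 1 -> depth C <= d ->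
  csp C d k <-> exists2 s, is_rank C k s & circuit_value C (rank_set k s).
Proof.
move=> okC w1 dd; split=> [[phi H]|[s [s0 sk sm si] cv]]; last first.
  apply: (csp_of_rank okC s0 sk sm si) => //.
    by move: w1; rewrite /weft -nth_last size_sweep.
  by move: dd; rewrite /depth -nth_last size_sweep.
have Hv sg : sg \in slots d k -> valid C d k (phi sg).
  by move=> /H[]; rewrite mem_filter => /andP[].
pose m := 2 ^ d.+1; have m0 : 0 < m by rewrite expn_gt0.
have cst i : i <= k.+1 -> nseq m i \in slots d k.
  by move=> ik; rewrite mem_allseq size_nseq eqxx; apply/allP => j /nseqP[-> _]; rewrite mem_iota.
have mn sg sg' : sg \in slots d k -> sg' \in slots d k -> mono (phi sg).1 (phi sg').1.
  move=> sgin sgin'; case: (eqVneq sg sg') => [<-|neq].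
    by have /and5P[] := Hv _ sgin.
  by have [_ _ /(_ _ sgin' neq)/and4P[]] := H _ sgin.
pose s i := (head (0, 0) (phi (nseq m i)).1).2.
have sin i : i <= k.+1 -> (i, s i) \in (phi (nseq m i)).1.
  move=> ik; have [_ sl _] := H _ (cst _ ik); move: sl; rewrite /slot /s.
  case: (phi (nseq m i)).1 => [|[j p] cs] /=; first by case: (m) m0.
  by case: (m) m0 => // m' _ [-> _]; rewrite mem_head.
have good sg : sg \in slots d k -> good_cells k s (phi sg).1.
  move=> sgin i p ip; have [_ sl _] := H _ sgin.
  have ik : i <= k.+1.
    have : i \in sg by rewrite -sl; apply/mapP; exists (i, p).
    by move: sgin; rewrite mem_allseq => /andP[_ /allP al] /al; rewrite mem_iota.
  (* The two directions of [mono], applied at the equal indices, give the two inequalities. *)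
  split=> //; apply/eqP; rewrite eqn_leq.
  have /monoP M1 := mn _ _ sgin (cst _ ik); have /monoP M2 := mn _ _ (cst _ ik) sgin.
  by rewrite -(M1 _ _ _ _ ip (sin _ ik)) -(M2 _ _ _ _ (sin _ ik) ip) leqnn.
have cok i : i <= k.+1 -> cell_ok C k (i, s i).
  by move=> ik; have /and5P[/allP al _ _ _ _] := Hv _ (cst _ ik); apply: al; apply: sin.
have sm i j : i <= k.+1 -> j <= k.+1 -> (i <= j) = (s i <= s j).
  move=> ik jk; have /monoP M := mn _ _ (cst _ ik) (cst _ jk).
  exact: M (sin _ ik) (sin _ jk).
have s0 : s 0 = 0 by have /eqP := cok 0 isT.
have sk : s k.+1 = (size C).+1.
  by have := cok k.+1 (leqnn _); rewrite /cell_ok /= eqxx => /eqP.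
have si i : 0 < i <= k -> is_input (nth Input C (s i).-1).
  move=> ik; have := cok i; rewrite /cell_ok /= !ifF; [|lia..].
  by move=> /(_ _)/and3P[] //; lia.
exists s; first by split.
apply: (@rank_of_csp C d k okC s s0 sk phi (phi (nseq m 0)).2).
move=> sg sgin; have [_ sl cp] := H _ sgin; split=> //; [exact: Hv| |exact: good].
case: (eqVneq sg (nseq m 0)) => [->//|neq].
by have /andP[/eqP-> _] := cp _ (cst 0 isT) neq.
Qed.

Lemma eq_circuit_value C a a' : a =1 a' -> circuit_value C a = circuit_value C a'.
Proof.
move=> aa; rewrite /circuit_value /sweep; congr last; apply: eq_foldl => vs g.
by rewrite /gate_value; case: g => // ; rewrite aa.
Qed.

(** The values of an enumeration, shifted back, form the set. Conversely the sorted set, shifted by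
    one and framed by the sentinels, is an enumeration. *)
Lemma rank_sat C k : (exists2 s, is_rank C k s & circuit_value C (rank_set k s)) <->
  weighted_sat C k.
Proof.
pose n := size C; split=> [[s [s0 sk sm si] cv]|[S [Sinp cardS cv]]].
  have rg i : 0 < i <= k -> 0 < s i <= n by exact: (s_range s0 sk sm).
  pose L := [seq (s i).-1 | i <- iota 1 k].
  have uL : uniq L.
    rewrite map_inj_in_uniq ?iota_uniq // => i j; rewrite !mem_iota => ik jk E.
    have [ri rj] : 0 < s i <= n /\ 0 < s j <= n by split; apply: rg; lia.
    have := sm i j; have := sm j i; lia.
  have ltL p : p \in L -> p < n.
    by case/mapP=> i; rewrite mem_iota => ik ->; have := rg i; lia.
  exists [set i : 'I_n | val i \in L].
  have eL : [seq val i | i in [set i : 'I_n | val i \in L]] =i L.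
    move=> p; apply/imageP/idP => [[i + ->]|pL]; first by rewrite inE.
    by exists (Ordinal (ltL _ pL)) => //; rewrite inE.
  have inL p : (p \in L) = rank_set k s p.
    apply/mapP/hasP => [[i iin E]|[i iin /eqP E]]; exists i => //; last by rewrite E.
    by move: iin; rewrite mem_iota => ik; rewrite E prednK //; have := rg i; lia.
  split.
  - by move=> i; rewrite inE => /mapP[j]; rewrite mem_iota => jk ->; apply: si; lia.
  - rewrite -(size_iota 1 k) -(size_map (fun i => (s i).-1)) -/L.
    have /perm_size <- : perm_eq [seq val i | i in [set i : 'I_n | val i \in L]] L.
      apply: uniq_perm => //; rewrite map_inj_uniq ?enum_uniq //; exact: val_inj.
    by rewrite size_image.
  - by rewrite (@eq_circuit_value _ _ (rank_set k s)) // => p; rewrite eL inL.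
pose l := sort leq [seq val i | i in S].
have szl : size l = k by rewrite size_sort size_image.
have meml : l =i [seq val i | i in S] by move=> p; rewrite mem_sort.
have ul : uniq l by rewrite sort_uniq map_inj_uniq ?enum_uniq //; exact: val_inj.
have ltl p : p \in l -> p < n by rewrite meml => /imageP[i _ ->]; exact: ltn_ord.
pose l' := 0 :: rcons (map succn l) n.+1.
have srt : sorted ltn l'.
  rewrite /= rcons_path; apply/andP; split; last first.
    case/lastP E: l => [//|l1 p]; rewrite map_rcons last_rcons /= ltnS.
    by apply: ltl; rewrite E mem_rcons mem_head.
  rewrite path_sortedE; last exact: ltn_trans.
  apply/andP; split; first by apply/allP => _ /mapP[p _ ->].
  rewrite sorted_map -(eq_sorted (e := ltn)) //.
  by rewrite ltn_sorted_uniq_leq ul sort_sorted //; exact: leq_total.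
have szl' : size l' = k.+2 by rewrite /= size_rcons size_map szl.
have nthl i : 0 < i <= k -> nth 0 l' i = (nth 0 l i.-1).+1.
  case: i => // i ik; rewrite /= nth_rcons size_map szl ifT; last lia.
  by rewrite (nth_map 0) // szl; lia.
exists (nth 0 l').
  split.
  - by [].
  - by rewrite /= nth_rcons size_map szl ltnn eqxx.
  - move=> i j ik jk; have lt a b : b <= k.+1 -> a < b -> nth 0 l' a < nth 0 l' b.
      move=> bk ab; apply: (sorted_ltn_nth ltn_trans 0 srt) => //; rewrite inE szl'; lia.
    case: (ltngtP i j) => [ij|ij|->]; last by rewrite leqnn.
      by have := lt _ _ jk ij; lia.
    by have := lt _ _ ik ij; lia.
  - move=> i ik; rewrite nthl //=.
    have : nth 0 l i.-1 \in l by rewrite mem_nth // szl; lia.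
    by rewrite meml => /imageP[p pS ->]; apply: Sinp.
rewrite (@eq_circuit_value _ _ (fun j => j \in [seq val i | i in S])) // => p.
rewrite -meml; apply/hasP/idP => [[i]|/(nthP 0)[i ik <-]].
  rewrite mem_iota => ik; rewrite nthl; last lia.
  by move=> /eqP[<-]; rewrite mem_nth // szl; lia.
rewrite szl in ik; exists i.+1; first by rewrite mem_iota; lia.
by rewrite nthl.
Qed.

Lemma csp_sat C d k : circuit_ok C -> weft C <= 1 -> depth C <= d ->
  csp C d k <-> weighted_sat C k.
Proof.
by move=> okC w1 dd; rewrite -rank_sat; apply: csp_rank.
Qed.

(** * The Stars instance *)

Section Gadget.
Variables (D T : eqType) (slt : D -> T) (cpt : rel D) (dummy : T -> D).
Variables (U : seq D) (sl : seq T).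
Hypotheses (cptC : symmetric cpt) (cptxx : irreflexive cpt).
Hypothesis slt_dummy : forall t, slt (dummy t) = t.
Hypothesis uniq_sl : uniq sl.

Notation vertex := (nat * D)%type.

(** A vertex tagged 0 is a candidate, one tagged 1 is its shadow, and all others
    are private to the community of their slot.  The weight from a candidate to
    the shadow of [u] complements the weight to [u], so that all stars of a
    community centred at its candidates weigh the same. *)
Definition heavy (x y : vertex) : bool :=
  if x.1 == 0 then
    if y.1 == 0 then cpt x.2 y.2
    else if y.1 == 1 then ~~ cpt x.2 y.2 else slt x.2 != slt y.2
  else if y.1 == 0 then
    if x.1 == 1 then ~~ cpt x.2 y.2 else slt x.2 != slt y.2
  else true.

Definition member (t : T) (x : vertex) : bool := (x.1 < 2) || (slt x.2 == t).

(** A private vertex carries [dummy t] merely as a bearer of its slot [t]. *)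
Definition verts L : seq vertex :=
  [seq (0, u) | u <- U] ++ ([seq (1, u) | u <- U] ++
  [seq (j.+2, dummy t) | t <- sl, j <- iota 0 L]).

Let K := size sl.
Let M := size U.
(** Each slot gets [L] private vertices, so many that a single bad centre exceeds the budget [b].
    The value of [b] is K(3M + L) - K^2: each of the K stars weighs 3M + L if a loop of weight 1 at
    its centre is included, and K^2 accounts for these loops and for the second copies of the edges
    between centres when all of these are heavy. *)
Let L := 3 * (K * M) + K + 2.
Let b := K * (3 * (K.+1 * M) + 2).
Let N := size (verts L).
Let dv (v : 'I_N) : vertex := tnth (in_tuple (verts L)) v.
Let sg (i : 'I_K) : T := tnth (in_tuple sl) i.

Definition gedges (n : nat) : {set {set 'I_n}} := [set e : {set 'I_n} | #|e| == 2].

Definition gweight (e : {set 'I_N}) : nat :=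
  1 + [exists u, exists v, (e == [set u; v]) && heavy (dv u) (dv v)].

Definition gcomm (t : T) : {set 'I_N} := [set v | member t (dv v)].

Definition solvable_choice : Prop := exists u : 'I_K -> D,
  forall i, [/\ u i \in U, slt (u i) = sg i & forall j, i != j -> cpt (u i) (u j)].

Lemma heavyC x y : heavy x y = heavy y x.
Proof.
rewrite /heavy (cptC x.2) (eq_sym (slt x.2)).
by case: (x.1 == 0); case: (y.1 == 0).
Qed.

Lemma set2_eq (n : nat) (u v u' v' : 'I_n) : [set u; v] = [set u'; v'] -> u != v ->
  (u = u' /\ v = v') \/ (u = v' /\ v = u').
Proof.
move=> E neq; have : u \in [set u'; v'] by rewrite -E !inE eqxx.
have : v \in [set u'; v'] by rewrite -E !inE eqxx orbT.
rewrite !inE => /orP[]/eqP Ev /orP[]/eqP Eu; [|by right|by left|];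
  by rewrite Ev Eu eqxx in neq.
Qed.

Lemma gweight2 u v : u != v -> gweight [set u; v] = 1 + heavy (dv u) (dv v).
Proof.
move=> neq; rewrite /gweight; congr (1 + nat_of_bool _).
apply/existsP/idP => [[u' /existsP[v' /andP[/eqP E h]]]|h].
  by case: (set2_eq E neq) => [[-> ->]|[-> ->]] //; rewrite heavyC.
by exists u; apply/existsP; exists v; rewrite eqxx.
Qed.

Lemma sum_verts (p : pred vertex) (f : vertex -> nat) :
  \sum_(v : 'I_N | p (dv v)) f (dv v) = \sum_(x <- verts L | p x) f x.
Proof. by rewrite [RHS]big_tnth. Qed.

Lemma sg_inj : injective sg.
Proof. by move=> i j; apply/tuple_uniqP. Qed.

Lemma sum_private t (F : vertex -> nat) n : t \in sl ->
  (forall j, F (j.+2, dummy t) = n) ->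
  \sum_(x <- verts L | (1 < x.1) && (slt x.2 == t)) F x = L * n.
Proof.
move=> tin HF; rewrite /verts !big_cat !big_map /= !big_pred0_eq !add0n.
rewrite big_mkcond big_allpairs_dep /= (bigD1_seq t) //= [X in _ + X]big1; last first.
  by move=> t' neq; rewrite big1 // => j _; rewrite slt_dummy (negbTE neq).
rewrite addn0; under eq_bigr => j _ do rewrite slt_dummy eqxx HF.
by rewrite big_const_seq iter_addn_0 count_predT size_iota mulnC.
Qed.

Lemma dv_in v : dv v \in verts L.
Proof. exact: mem_tnth. Qed.

Lemma dv_cand v : (dv v).1 = 0 -> (dv v).2 \in U.
Proof.
have := dv_in v; rewrite /verts !mem_cat => /or3P[] /=.
- by case/mapP=> u uU ->.
- by case/mapP=> u uU ->.
- by case/allpairsP=> tj [_ _ ->].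
Qed.

Lemma cand_dv u : u \in U -> exists v, dv v = (0, u).
Proof.
move=> uU; have : (0, u) \in verts L by rewrite mem_cat map_f.
by case/(tnthP (in_tuple (verts L))) => v; exists v.
Qed.

Lemma leq_sum_inj (A : finType) (X : {set A}) (g : A -> {set 'I_N}) (F : {set {set 'I_N}}) :
  {in X &, injective g} -> (forall x, x \in X -> g x \in F) ->
  \sum_(x in X) gweight (g x) <= \sum_(e in F) gweight e.
Proof.
move=> gi gF; rewrite -(big_imset _ gi) /=.
rewrite [leqRHS](big_setID (g @: X)) /= (setIidPr _) ?leq_addr //.
by apply/subsetP => _ /imsetP[x /gF ? ->].
Qed.

(** * Within the budget, every centre is a candidate of its own slot *)

Section Bad.
Variables (F : {set {set 'I_N}}) (c : 'I_K -> 'I_N).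
Hypothesis leF : \sum_(e in F) gweight e <= b.
Hypothesis cin : forall i, c i \in gcomm (sg i).
Hypothesis cst : forall i v, v \in gcomm (sg i) -> v != c i -> [set c i; v] \in F.

Definition good_center i := ((dv (c i)).1 == 0) && (slt (dv (c i)).2 == sg i).

Definition private i v := (1 < (dv v).1) && (slt (dv v).2 == sg i).

Lemma sg_in i : sg i \in sl. Proof. exact: mem_tnth. Qed.

Lemma center_private i j : private j (c i) -> i = j.
Proof.
case/andP=> tg /eqP sE; have := cin i; rewrite inE /member ltnNge tg /= sE.
by move/eqP/sg_inj.
Qed.

(** A bad centre is a candidate of another slot or no candidate at all; in both cases [heavy]
    charges its edges to private vertices. *)
Lemma heavy_private i v : ~~ good_center i -> private i v -> heavy (dv (c i)) (dv v).
Proof.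
move=> bad /andP[tv /eqP sv]; rewrite /heavy sv; move: bad; rewrite /good_center.
case: eqP => _ /= bad; last by case: eqP tv => [->|].
by rewrite !ifF //; apply/negbTE; case: (dv v).1 tv => [|[|]].
Qed.

(** A private vertex lies in one community only, so the edges from centres to private vertices are
    distinct for distinct communities. Their weight alone exceeds the budget if one centre is
    bad. *)
Lemma centers_good i : good_center i.
Proof.
apply: contraT => bad.
pose X := [set x : 'I_K * 'I_N | private x.1 x.2 && (x.2 != c x.1)].
pose g (x : 'I_K * 'I_N) := [set c x.1; x.2].
have ginj : {in X &, injective g}.
  move=> [i1 v1] [i2 v2]; rewrite !inE /= => /andP[p1 n1] /andP[p2 n2] E.
  have [|[/= Ec Ev]|[/= Ec Ev]] := set2_eq E; first by rewrite eq_sym.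
    rewrite Ev; congr (_, _); apply: sg_inj.
    by move: p1 p2; rewrite -Ev /private => /andP[_ /eqP<-] /andP[_ /eqP<-].
  have E12 : i1 = i2 by apply: center_private; rewrite Ec.
  by move: n1; rewrite Ev E12 eqxx.
have gF x : x \in X -> g x \in F.
  case: x => j v; rewrite inE /= => /andP[/andP[_ pv] nv]; apply: cst => //.
  by rewrite inE /member pv orbT.
have := leq_trans (leq_sum_inj ginj gF) leF.
pose n j := 1 + ~~ good_center j.
(* The extra [n j] makes up for the centre, which may itself be one of the [L] private vertices. *)
have lb j : L * n j <= n j + \sum_(v | private j v && (v != c j)) gweight (g (j, v)).
  have -> : L * n j = \sum_(v | private j v) n j.
    rewrite /private (sum_verts (fun x => (1 < x.1) && (slt x.2 == sg j)) (fun=> n j)).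
    by rewrite (sum_private (n := n j)) // sg_in.
  apply: (@leq_trans (n j + \sum_(v | private j v && (v != c j)) n j)).
    case pc: (private j (c j)); first by rewrite (bigD1 (c j)).
    rewrite (eq_bigl (fun v => private j v && (v != c j))) ?leq_addl // => v.
    by case: eqP => [->|]; rewrite ?pc ?andbT.
  rewrite leq_add2l; apply: leq_sum => v /andP[pv nv].
  rewrite gweight2; last by rewrite eq_sym.
  rewrite leq_add2l; case gj: (good_center j) => //.
  by rewrite heavy_private // gj.
have -> : \sum_(x in X) gweight (g x) =
    \sum_j \sum_(v | private j v && (v != c j)) gweight (g (j, v)).
  rewrite pair_big_dep /=; apply: eq_big => [[j v]|[j v] _] //; by rewrite inE.
move=> leb; have : \sum_j L * n j <= \sum_j n j + b.
  apply: leq_trans (leq_sum _ (fun j _ => lb j)) _.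
  by rewrite big_split leq_add2l.
rewrite -big_distrr /=.
(* With the sum at least [K.+1], the inequality would give (L - 1)(K + 1) <= b, which the choice of
   [L] excludes. *)
have : K.+1 <= \sum_j n j.
  rewrite big_split /= sum1_card card_ord -addn1 leq_add2l (bigD1 i) //= bad.
  by rewrite leq_addr.
move: (\sum_j n j) => S; rewrite /L /b; nia.
Qed.
End Bad.

(** * The total weight of stars with good centres *)

Section Good.
Variable c : 'I_K -> 'I_N.
Hypothesis cgood : forall i, (dv (c i)).1 = 0 /\ slt (dv (c i)).2 = sg i.

(** The weight of the edge between two centres; for [i = j] it is the weight 1 of the loop counted
    in [sum_star]. *)
Definition cw i j : nat := 1 + cpt (dv (c i)).2 (dv (c j)).2.

Lemma c_inj : injective c.
Proof.
by move=> i j E; apply: sg_inj; rewrite -(proj2 (cgood i)) -(proj2 (cgood j)) E.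
Qed.

Lemma c_in i j : c j \in gcomm (sg i).
Proof. by rewrite inE /member (proj1 (cgood j)). Qed.

(** A candidate and its shadow have complementary weights, together 3, whatever the centre; private
    vertices of the right slot weigh 1. The sum includes a loop at the centre. *)
Lemma sum_star i : \sum_(v in gcomm (sg i)) (1 + heavy (dv (c i)) (dv v)) = 3 * M + L.
Proof.
rewrite (eq_bigl (fun v => member (sg i) (dv v))); last by move=> v; rewrite inE.
rewrite (sum_verts (member (sg i)) (fun x => 1 + heavy (dv (c i)) x)).
have [t0 s0] := cgood i.
have privE : \sum_(x <- verts L | (1 < x.1) && (slt x.2 == sg i)) (1 + heavy (dv (c i)) x) = L.
  rewrite (sum_private (n := 1)) ?muln1 ?mem_tnth // => j.
  by rewrite /heavy t0 /= slt_dummy s0 eqxx.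
rewrite (bigID (fun x => x.1 < 2)) /=; congr (_ + _); last first.
  rewrite -[RHS]privE; apply: eq_bigl => x; rewrite /member ltnNge.
  by case: (1 < x.1); rewrite /= ?andbT.
rewrite (eq_bigl (fun x : vertex => x.1 < 2)); last first.
  by move=> x; rewrite /member andbC; case: (x.1 < 2).
rewrite /verts !big_cat !big_map /= [X in _ + (_ + X)]big_mkcond big_allpairs_dep /=.
rewrite [X in _ + (_ + X)]big1 ?addn0; last by move=> t _; rewrite big1.
rewrite -big_split /= /heavy t0 /= (eq_bigr (fun=> 3)); last first.
  by move=> u _; case: (cpt _ _).
by rewrite big_const_seq iter_addn_0 count_predT.
Qed.

(** Each edge of the union of the stars is listed once: loops are dropped, and an edge between two
    centres is kept at the smaller index only. *)
Definition star_pairs : {set 'I_K * 'I_N} :=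
  [set x | (x.2 \in gcomm (sg x.1)) && (x.2 \notin c @: [set j : 'I_K | j <= x.1])].

Definition star_edge (x : 'I_K * 'I_N) : {set 'I_N} := [set c x.1; x.2].

Lemma star_pair_neq x : x \in star_pairs -> x.2 != c x.1.
Proof.
rewrite inE => /andP[_]; apply: contra => /eqP->.
by apply: imset_f; rewrite inE.
Qed.

Lemma star_edge_inj : {in star_pairs &, injective star_edge}.
Proof.
move=> [i1 v1] [i2 v2] x1 x2 E; have /= n1 := star_pair_neq x1.
have [|[/= Ec Ev]|[/= Ec Ev]] := set2_eq E; first by rewrite eq_sym.
  by rewrite Ev (c_inj Ec).
move: x1 x2; rewrite !inE /= Ev -Ec => /andP[_ N1] /andP[_ N2].
have : ~~ (i2 <= i1) by apply: contra N1 => le; apply: imset_f; rewrite inE.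
have : ~~ (i1 <= i2) by apply: contra N2 => le; apply: imset_f; rewrite inE.
by lia.
Qed.

(** The full stars differ from the listed edges exactly by the loops and the second copies of the
    edges between centres. *)
Lemma sum_star_pairs :
  \sum_(x in star_pairs) gweight (star_edge x) + \sum_(i < K) \sum_(j < K | j <= i) cw i j =
  K * (3 * M + L).
Proof.
have -> : \sum_(x in star_pairs) gweight (star_edge x) =
   \sum_(i < K) \sum_(v | (v \in gcomm (sg i)) && (v \notin c @: [set j : 'I_K | j <= i]))
     (1 + heavy (dv (c i)) (dv v)).
  rewrite pair_big_dep /=; apply: eq_big => [[i v]|[i v] x1]; first by rewrite inE.
  by rewrite gweight2 // eq_sym (star_pair_neq x1).
have -> : K * (3 * M + L) = \sum_(i < K) (3 * M + L) by rewrite sum_nat_const card_ord.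
rewrite -big_split /=; apply: eq_bigr => i _.
rewrite -(sum_star i) [RHS](bigID (mem (c @: [set j : 'I_K | j <= i]))) /= addnC.
congr (_ + _).
rewrite (eq_bigl (mem (c @: [set j : 'I_K | j <= i]))); last first.
  by move=> v /=; rewrite andb_idl // => /imsetP[j _ ->]; exact: c_in.
rewrite big_imset /=; last by move=> ? ? _ _; apply: c_inj.
apply: eq_big => [j|j _]; first by rewrite inE.
by rewrite /heavy (proj1 (cgood i)) (proj1 (cgood j)).
Qed.

(** The sum of the first [K] odd numbers. *)
Lemma sum_triangle : \sum_(i < K) \sum_(j < K | j <= i) (1 + (i != j)) = K * K.
Proof.
have -> : \sum_(i < K) \sum_(j < K | j <= i) (1 + (i != j)) = \sum_(i < K) (i.*2).+1.
  apply: eq_bigr => i _; rewrite (bigD1 i) //= eqxx add1n; congr _.+1.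
  rewrite (eq_bigl (fun j : 'I_K => j < i)); last first.
    by move=> j; rewrite ltn_neqAle andbC.
  rewrite (eq_bigr (fun=> 2)); last by move=> j lt_ji; case: eqP lt_ji => // ->; rewrite ltnn.
  rewrite -(big_ord_widen K (fun=> 2)) ?(ltnW (ltn_ord i)) //.
  by rewrite sum_nat_const card_ord muln2.
elim: (K) => [|n IH]; first by rewrite big_ord0.
by rewrite big_ord_recr /= IH; lia.
Qed.

(** The weight is b + K^2 minus the sum of the [cw i j] over [j <= i]. Each term is at most
    [1 + (i != j)], and these bounds add up to K^2, so the budget is met iff every term attains its
    bound. *)
Lemma star_pairs_opt : (\sum_(x in star_pairs) gweight (star_edge x) <= b) <->
  (forall i j, i != j -> cpt (dv (c i)).2 (dv (c j)).2).
Proof.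
have E := sum_star_pairs; have Eb : K * (3 * M + L) = b + K * K.
  by rewrite /L /b; nia.
rewrite Eb -sum_triangle in E.
have cwE i j : cw i j <= 1 + (i != j).
  by rewrite /cw; case: eqP => [->|_]; rewrite ?cptxx //; case: (cpt _ _).
split=> [le|all_cpt]; last first.
  have E2 : \sum_(i < K) \sum_(j < K | j <= i) cw i j =
      \sum_(i < K) \sum_(j < K | j <= i) (1 + (i != j)).
    apply: eq_bigr => i _; apply: eq_bigr => j _; rewrite /cw.
    by case: eqP => [->|/eqP/all_cpt->]; rewrite ?cptxx.
  by rewrite E2 in E; lia.
(* Since the total of the bounds is reached, each term must reach its own. *)
have E0 : \sum_(i < K) \sum_(j < K | j <= i) ((1 + (i != j)) - cw i j) = 0.
  have Es : \sum_(i < K) \sum_(j < K | j <= i) ((1 + (i != j)) - cw i j) +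
      \sum_(i < K) \sum_(j < K | j <= i) cw i j =
      \sum_(i < K) \sum_(j < K | j <= i) (1 + (i != j)).
    rewrite -big_split; apply: eq_bigr => i _; rewrite -big_split.
    by apply: eq_bigr => j _; rewrite /= subnK.
  by lia.
have half (i j : 'I_K) : j <= i -> i != j -> cpt (dv (c i)).2 (dv (c j)).2.
  move=> ji neq; move/eqP: E0; rewrite sum_nat_eq0 => /forallP/(_ i)/=.
  rewrite sum_nat_eq0 => /forallP/(_ j)/implyP/(_ ji); rewrite /cw neq.
  by case: (cpt _ _).
move=> i j neq; case: (leqP j i) => [le_ji|/ltnW le_ij]; first exact: half.
by rewrite cptC; apply: half; rewrite // eq_sym.
Qed.

End Good.

Lemma gadget_solvable :
  (exists F : {set {set 'I_N}}, [/\ F \subset gedges N,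
     \sum_(e in F) gweight e <= b & forall t, t \in sl -> star_in F (gcomm t)]) <->
  solvable_choice.
Proof.
split=> [[F [Fsub leF stF]]|[u Hu]].
  have /fin_all_exists[c Hc] (i : 'I_K) : exists v, v \in gcomm (sg i) /\
      forall w, w \in gcomm (sg i) -> w != v -> [set v; w] \in F.
    by have [v vin Hv] := stF (sg i) (mem_tnth _ _); exists v.
  have cin i := proj1 (Hc i); have cst i := proj2 (Hc i).
  have gd i : (dv (c i)).1 = 0 /\ slt (dv (c i)).2 = sg i.
    by have /andP[/eqP? /eqP?] := centers_good leF cin cst i.
  have sub x : x \in star_pairs c -> star_edge c x \in F.
    move=> xin; apply: cst; last exact: star_pair_neq xin.
    by move: xin; rewrite inE => /andP[].
  have le := leq_trans (leq_sum_inj (star_edge_inj gd) sub) leF.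
  exists (fun i => (dv (c i)).2) => i; have [t0 s0] := gd i; split=> //.
    exact: dv_cand.
  by move=> j; apply: (star_pairs_opt gd).1.
have /fin_all_exists[c Hc] (i : 'I_K) : exists v, dv v = (0, u i).
  by apply: cand_dv; have [] := Hu i.
have gd i : (dv (c i)).1 = 0 /\ slt (dv (c i)).2 = sg i.
  by rewrite Hc; have [] := Hu i.
exists (star_edge c @: star_pairs c); split.
- apply/subsetP => _ /imsetP[x xin ->]; rewrite inE cards2.
  by have := star_pair_neq xin; rewrite eq_sym => ->.
- rewrite big_imset /=; last exact: star_edge_inj gd.
  by apply/(star_pairs_opt gd) => i j neq; rewrite !Hc; have [_ _ ->] := Hu i.
- move=> t /(tnthP (in_tuple sl))[i ->]; exists (c i); first exact: c_in.
  (* An edge to a centre of smaller index is listed under that index. *)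
  move=> v vin nv; case: (boolP (v \in c @: [set j : 'I_K | j <= i])) => [|nin].
    case/imsetP=> j; rewrite inE => ji Ev; apply/imsetP; exists (j, c i); last first.
      by rewrite Ev /star_edge setUC.
    rewrite inE /= c_in //=; apply/imsetP => -[j']; rewrite inE => j'j /(c_inj gd) E.
    move: nv; rewrite Ev; have -> : j = i by apply/val_inj/eqP; rewrite eqn_leq ji E.
    by rewrite eqxx.
  by apply/imsetP; exists (i, v); rewrite ?inE /= ?nin ?andbT //; rewrite inE in vin.
Qed.
End Gadget.

(** * Decoding circuits *)

Lemma ptime_predn : ptime predn.
Proof. by apply: (@eq_ptime _ _ _ _ (fun n => n - 1)) => [n|]; [rewrite subn1 | pt]. Qed.
#[global] Hint Resolve ptime_predn : ptime.

Lemma ptime_dhd : ptime dhd.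
Proof.
apply: (@ptime_expr _ _ _ _ _ (fun b => EHd (EVar b))) => [b s a /= ->//|].
by apply: pb_le pb_sz => x; rewrite ltnS dsize_dhd.
Qed.

Lemma ptime_dtl : ptime dtl.
Proof.
apply: (@ptime_expr _ _ _ _ _ (fun b => ETl (EVar b))) => [b s a /= ->//|].
by apply: pb_le pb_sz => x; rewrite ltnS dsize_dtl.
Qed.

(** Every tree is the encoding of the list along its right spine, so trees can be inspected by list
    operations at no cost. *)
Fixpoint dlist (x : data) : seq data := if x is Node a b then a :: dlist b else [::].

Lemma enc_dlist x : enc (dlist x) = x.
Proof. by elim: x => // a _ b IH; rewrite /= enc_cons IH. Qed.

Lemma dlist_enc_list T (f : T -> data) s : dlist (enc_list f s) = map f s.
Proof. by elim: s => //= x s ->. Qed.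

Lemma ptime_dlist : ptime dlist.
Proof. by apply: ptime_recode => x; rewrite enc_dlist. Qed.
#[global] Hint Resolve ptime_dhd ptime_dtl ptime_dlist : ptime.

Definition dlen (x : data) : nat := size (dlist x).

Lemma dlen_unary n : dlen (enc_unary n) = n.
Proof. by rewrite /dlen; elim: n => //= n ->. Qed.

Lemma ptime_dlen : ptime dlen.
Proof. by rewrite /dlen; pt. Qed.
#[global] Hint Resolve ptime_dlen : ptime.

Definition is_unary (x : data) : bool := all (fun y => nilp (dlist y)) (dlist x).

Lemma is_unaryP x : is_unary x -> enc_unary (dlen x) = x.
Proof.
rewrite /is_unary /dlen; elim: x => //= a _ b IH /andP[a0 /IH ->].
by case: a a0.
Qed.

Lemma is_unary_enc n : is_unary (enc_unary n).
Proof. by rewrite /is_unary; elim: n. Qed.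

Lemma ptime_is_unary : ptime is_unary.
Proof. by rewrite /is_unary; pt. Qed.
#[global] Hint Resolve ptime_is_unary : ptime.

(** A total decoder; it inverts [enc_gate] on the trees accepted by [wf_gate]. *)
Definition dec_gate (x : data) : gate :=
  if dlen (dhd x) == 0 then Input
  else if dlen (dhd x) == 1 then Not (dlen (dtl x))
  else if dlen (dhd x) == 2 then And [seq dlen y | y <- dlist (dtl x)]
  else Or [seq dlen y | y <- dlist (dtl x)].

Definition wf_gate (x : data) : bool :=
  ~~ nilp (dlist x) && (is_unary (dhd x) && ((dlen (dhd x) <= 3) &&
    (if dlen (dhd x) == 0 then nilp (dlist (dtl x))
     else if dlen (dhd x) == 1 then is_unary (dtl x)
     else all is_unary (dlist (dtl x))))).

Definition dec (x : data) : seq gate := [seq dec_gate y | y <- dlist x].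
Definition wf (x : data) : bool := all wf_gate (dlist x).

Lemma enc_unaries x : all is_unary (dlist x) ->
  enc_list enc_unary [seq dlen y | y <- dlist x] = x.
Proof. by elim: x => //= a _ b IH /andP[/is_unaryP-> /IH->]. Qed.

Lemma unaries_enc js : [seq dlen y | y <- dlist (enc_list enc_unary js)] = js.
Proof. by rewrite dlist_enc_list -map_comp (eq_map dlen_unary) map_id. Qed.

Lemma wf_gateP x : wf_gate x -> enc_gate (dec_gate x) = x.
Proof.
case: x => // a b /andP[_ /andP[/is_unaryP ua /andP[]]]; rewrite /dec_gate /= in ua *.
case E: (dlen a) => [|[|[|[|]]]] //= _; rewrite -ua E.
- by case: b.
- by move/is_unaryP->.
- by move/enc_unaries->.
- by move/enc_unaries->.
Qed.

Lemma wf_gate_enc g : wf_gate (enc_gate g).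
Proof.
have au js : all is_unary (dlist (enc_list enc_unary js)).
  by rewrite dlist_enc_list; elim: js => //= j js ->; rewrite is_unary_enc.
by case: g => [|j|js|js] //=; rewrite /wf_gate /= ?is_unary_enc ?au.
Qed.

Lemma dec_gate_enc g : dec_gate (enc_gate g) = g.
Proof.
by case: g => [|j|js|js] //=; rewrite /dec_gate /= ?dlen_unary ?unaries_enc.
Qed.

Lemma wf_dec x : wf x -> enc_circuit (dec x) = x.
Proof.
rewrite /wf /dec /enc_circuit; elim: x => //= a _ b IH /andP[wa /IH ->].
by rewrite wf_gateP.
Qed.

Lemma wf_enc C : wf (enc_circuit C).
Proof.
by rewrite /wf dlist_enc_list; elim: C => //= g C ->; rewrite wf_gate_enc.
Qed.

Lemma dec_enc C : dec (enc_circuit C) = C.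
Proof. by rewrite /dec dlist_enc_list -map_comp (eq_map dec_gate_enc) map_id. Qed.

Lemma ptime_Not : ptime Not.
Proof.
apply: (@ptime_expr _ _ _ _ _ (fun b => ENode (edata (enc 1)) (EVar b))) => [b s a /= ->//|].
apply: (@pb_le _ _ _ (fun j => sz j + 10)); last by have ? : pbounded (@sz nat _) by [exact: pb_sz]; pb.
move=> j; have E : dsize (enc (Not j)) = (dsize (enc 1) + dsize (enc j)).+1 by [].
by rewrite /sz E (dsize_enc_nat 1); lia.
Qed.

Lemma ptime_And : ptime And.
Proof.
apply: (@ptime_expr _ _ _ _ _ (fun b => ENode (edata (enc 2)) (EVar b))) => [b s a /= ->//|].
apply: (@pb_le _ _ _ (fun js => sz js + 10)); last by have ? : pbounded (@sz (seq nat) _) by [exact: pb_sz]; pb.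
move=> j; have E : dsize (enc (And j)) = (dsize (enc 2) + dsize (enc j)).+1 by [].
by rewrite /sz E (dsize_enc_nat 2); lia.
Qed.

Lemma ptime_Or : ptime Or.
Proof.
apply: (@ptime_expr _ _ _ _ _ (fun b => ENode (edata (enc 3)) (EVar b))) => [b s a /= ->//|].
apply: (@pb_le _ _ _ (fun js => sz js + 10)); last by have ? : pbounded (@sz (seq nat) _) by [exact: pb_sz]; pb.
move=> j; have E : dsize (enc (Or j)) = (dsize (enc 3) + dsize (enc j)).+1 by [].
by rewrite /sz E (dsize_enc_nat 3); lia.
Qed.
#[global] Hint Resolve ptime_Not ptime_And ptime_Or : ptime.

Lemma ptime_dec : ptime dec.
Proof. by rewrite /dec /dec_gate; pt. Qed.

Lemma ptime_wf : ptime wf.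
Proof. by rewrite /wf /wf_gate; pt. Qed.
#[global] Hint Resolve ptime_dec ptime_wf : ptime.

(** The constructor number, by which case distinctions on gates become tests available to
    [ptime]. *)
Definition gtag (g : gate) : nat := dlen (dhd (enc_gate g)).

Lemma ptime_enc_gate : ptime enc_gate.
Proof. exact: ptime_recode. Qed.
#[global] Hint Resolve ptime_enc_gate : ptime.

Lemma ptime_gtag : ptime gtag.
Proof. by rewrite /gtag; pt. Qed.
#[global] Hint Resolve ptime_gtag : ptime.

Lemma ptime_preds : ptime preds.
Proof.
apply: (@eq_ptime _ _ _ _ (fun g => if gtag g == 1 then [:: dlen (dtl (enc_gate g))]
    else [seq dlen y | y <- dlist (dtl (enc_gate g))])); last by pt.
by case=> [|j|js|js] /=; rewrite /= ?dlen_unary ?unaries_enc.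
Qed.

Lemma ptime_is_input : ptime is_input.
Proof. by apply: (@eq_ptime _ _ _ _ (fun g => gtag g == 0)); [case|pt]. Qed.
#[global] Hint Resolve ptime_preds ptime_is_input : ptime.

Lemma ptime_uniq : ptime (fun s : seq nat => uniq s).
Proof.
apply: (@eq_ptime _ _ _ _ (fun s : seq nat => all (fun i : nat => all (fun j : nat =>
  (i == j) || ~~ (nth 0 s i == nth 0 s j)) (iota 0 (size s))) (iota 0 (size s)))); last by pt.
move=> s; apply/allP/(uniqP 0) => [H i j ilt jlt E|H i].
  have := H i; rewrite mem_iota => /(_ ilt)/allP/(_ j); rewrite mem_iota => /(_ jlt).
  by rewrite E eqxx orbF => /eqP.
rewrite mem_iota => ilt; apply/allP => j; rewrite mem_iota => jlt.
by case: (eqVneq i j) => //= neq; apply: contra neq => /eqP/(H _ _ ilt jlt)->.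
Qed.

Ltac pt_special ::= lazymatch goal with
  | |- ptime (fun a => uniq (@?f a)) => refine (ptime_comp ptime_uniq (f := f) _)
  end.

Lemma ptime_gate_ok : ptime gate_ok.
Proof.
apply: (@eq_ptime _ _ _ _ (fun g => if gtag g <= 1 then true
  else uniq (preds g) && (1 < size (preds g)))); last by pt.
by case.
Qed.
#[global] Hint Resolve ptime_gate_ok : ptime.

Lemma ptime_circuit_ok : ptime (fun C : seq gate => circuit_ok C).
Proof.
apply: (@eq_ptime _ _ _ _ (fun C : seq gate => (0 < size C) && (all gate_ok C &&
  all (fun i => all (fun j => j < i) (preds (nth Input C i))) (iota 0 (size C))))).
  by [].
by pt.
Qed.
#[global] Hint Resolve ptime_circuit_ok : ptime.

(** The table stays polynomial because its entries grow at most linearly with their position. *)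
Lemma ptime_sweep A X {EA : Enc A} {EX : Enc X} (x0 : X) (h : A -> seq X -> gate -> X)
    (C : A -> seq gate) (c : nat) :
  ptime (fun z : A * seq X * gate => h z.1.1 z.1.2 z.2) -> ptime C ->
  (forall a P i, sz (nth x0 (sweep (h a) P) i) <= c + i.*2) ->
  ptime (fun a => sweep (h a) (C a)).
Proof.
move=> ph pC Hs; have pCs := ptime_size pC; rewrite /sweep.
apply: (@eq_ptime _ _ _ _
  (fun a => foldl (fun vs g => vs ++ [:: h a vs g]) [::] (C a))).
  by move=> a; apply: eq_foldl => vs g; rewrite cats1.
apply: (@ptime_foldl _ _ _ _ _ _ (fun a vs g => vs ++ [:: h a vs g]) (fun=> [::])) => //.
- refine (ptime_comp2 (F := @cat X) (f := fun z => z.1.2)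
    (g := fun z => [:: h z.1.1 z.1.2 z.2]) _ _ _); try by pt.
- exact: ptime_const.
exists (fun a => sz (C a) * (c + 2 * sz (C a)) + 1); first by pb.
move=> a i; rewrite (eq_foldl (g := fun vs g => rcons vs (h a vs g))); last first.
  by move=> vs g; rewrite cats1.
rewrite -/(sweep (h a) (take i (C a))) dsize_enc_seq addn1 ltnS.
set P := take i (C a).
have szP : size P <= sz (C a).
  apply: leqW; by apply: leq_trans (size_le_dsize _); rewrite size_take_min geq_minr.
rewrite (big_nth x0) size_sweep big_mkord.
apply: (@leq_trans (\sum_(j < size P) (c + 2 * sz (C a)))).
  apply: leq_sum => j _; apply: leq_trans (Hs a P j) _.
  by rewrite leq_add2l -mul2n leq_mul2l /=; apply: leq_trans szP; apply: ltnW.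
by rewrite sum_nat_const card_ord leq_mul2r szP orbT.
Qed.

Lemma bigmax_map (s js : seq nat) :
  \max_(j <- js) nth 0 s j = \max_(v <- [seq nth 0 s j | j <- js]) v.
Proof. by rewrite big_map. Qed.

Lemma ptime_gate_weft : ptime (fun z : seq nat * gate => gate_weft z.1 z.2).
Proof.
apply: (@eq_ptime _ _ _ _ (fun z => (if 2 < size (preds z.2) then 1 else 0) +
    \max_(v <- [seq nth 0 z.1 j | j <- preds z.2]) v)).
  by move=> z; rewrite /gate_weft bigmax_map /large; case: leqP.
refine (ptime_comp2 (F := addn) (f := fun z => if 2 < size (preds z.2) then 1 else 0)
  (g := fun z => _) _ _ _); try by pt.
by refine (ptime_comp ptime_bigmax (f := fun z => _) _); pt.
Qed.

Lemma ptime_gate_depth : ptime (fun z : seq nat * gate => gate_depth z.1 z.2).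
Proof.
apply: (@eq_ptime _ _ _ _ (fun z => if is_input z.2 then 0 else
    (\max_(v <- [seq nth 0 z.1 j | j <- preds z.2]) v).+1)).
  by move=> z; rewrite /gate_depth bigmax_map.
refine (ptime_if _ _ _); try by pt.
refine (ptime_comp ptime_succn (f := fun z => _) _).
by refine (ptime_comp ptime_bigmax (f := fun z => _) _); pt.
Qed.

(** * Running times *)

#[global] Hint Transparent circuit descr : ptime.

(** Each new node exceeds the previous maximum bound by at most one, so unary tables of weft and
    depth stay small. *)
Lemma sweep_nat_bound (h : seq nat -> gate -> nat) :
  (forall vs g, (forall x, x \in vs -> x <= size vs) -> h vs g <= (size vs).+1) ->
  forall C i, nth 0 (sweep h C) i <= i.+1.
Proof.
move=> Hh; have H C x : x \in sweep h C -> x <= size C.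
  elim/last_ind: C x => [//|C g IH] x; rewrite sweep_rcons mem_rcons inE size_rcons.
  case/orP=> [/eqP->|/IH/leqW//].
  by rewrite -[size C](size_sweep h); apply: Hh => y /IH; rewrite size_sweep.
move=> C i; case: (ltnP i (size C)) => lt_i; last by rewrite nth_default ?size_sweep.
apply: (leq_trans (H (take i.+1 C) _ _)); last by rewrite size_take_min geq_minl.
by rewrite -take_sweep -(@nth_take i.+1) // mem_nth // size_takel // size_sweep.
Qed.

Lemma max_nth_le (vs js : seq nat) n : (forall x, x \in vs -> x <= n) ->
  \max_(j <- js) nth 0 vs j <= n.
Proof.
move=> H; apply/bigmax_leqP_seq => j _ _; case: (ltnP j (size vs)) => lt_j.
  by apply: H; rewrite mem_nth.
by rewrite nth_default.
Qed.

Lemma ptime_sweep_weft : ptime (fun C : seq gate => sweep gate_weft C).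
Proof.
refine (ptime_sweep (x0 := 0) (h := fun _ => gate_weft) (C := fun C => C) (c := 4) _ _ _).
- refine (ptime_comp2 (F := gate_weft) (f := fun z => z.1.2) (g := fun z => z.2) _ _ _).
    exact: ptime_gate_weft.
  by pt.
  by pt.
- exact: ptime_id.
move=> _ P i; rewrite /sz dsize_enc_nat.
suff : nth 0 (sweep gate_weft P) i <= i.+1 by lia.
apply: sweep_nat_bound => vs g H; rewrite /gate_weft.
by have := max_nth_le (preds g) H; case: (large g); lia.
Qed.

Lemma ptime_sweep_depth : ptime (fun C : seq gate => sweep gate_depth C).
Proof.
refine (ptime_sweep (x0 := 0) (h := fun _ => gate_depth) (C := fun C => C) (c := 4) _ _ _).
- refine (ptime_comp2 (F := gate_depth) (f := fun z => z.1.2) (g := fun z => z.2) _ _ _).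
    exact: ptime_gate_depth.
  by pt.
  by pt.
- exact: ptime_id.
move=> _ P i; rewrite /sz dsize_enc_nat.
suff : nth 0 (sweep gate_depth P) i <= i.+1 by lia.
apply: sweep_nat_bound => vs g H; rewrite /gate_depth.
by have := max_nth_le (preds g) H; case: (is_input g); lia.
Qed.
#[global] Hint Resolve ptime_sweep_weft ptime_sweep_depth : ptime.

Lemma ptime_weft : ptime (fun C : seq gate => weft C).
Proof. by rewrite /weft; pt. Qed.

Lemma ptime_depth : ptime (fun C : seq gate => depth C).
Proof. by rewrite /depth; pt. Qed.
#[global] Hint Resolve ptime_weft ptime_depth : ptime.

Lemma ptime_easy : ptime (fun z : seq gate * nat * nat => easy z.1.1 z.1.2 z.2).
Proof. by rewrite /easy /nweft /ndepth; pt. Qed.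
#[global] Hint Resolve ptime_easy : ptime.

Definition allowed_dec d (C : seq gate) (f : nat * bool) : bool :=
  if gtag (nth Input C f.1) == 0 then true else if gtag (nth Input C f.1) == 1 then false
  else (if gtag (nth Input C f.1) == 2 then f.2 else ~~ f.2) &&
    all (easy C d) (preds (nth Input C f.1)).

Lemma allowed_decE d C f : allowed C d f.1 f.2 = allowed_dec d C f.
Proof. by rewrite /allowed /allowed_dec; case: (nth Input C f.1). Qed.

Lemma ptime_allowed :
  ptime (fun z : nat * seq gate * (nat * bool) => allowed_dec z.1.1 z.1.2 z.2).
Proof. by rewrite /allowed_dec; pt. Qed.

Lemma ptime_sel : ptime (fun z : bool * (bool * bool) => sel z.1 z.2).
Proof. by rewrite /sel; pt. Qed.
#[global] Hint Resolve ptime_allowed ptime_sel : ptime.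

Lemma ptime_gate_prov : ptime (fun z : seq (bool * bool) * seq (bool * bool) * gate =>
  gate_prov z.1.1 z.1.2 z.2).
Proof.
pose v vs j : bool * bool := nth (false, false) vs j.
have pv : ptime (fun z : seq (bool * bool) * nat => v z.1 z.2) by rewrite /v; pt.
apply: (@eq_ptime _ _ _ _ (fun z : seq (bool * bool) * seq (bool * bool) * gate =>
  if gtag z.2 == 0 then v z.1.1 (size z.1.2)
  else if gtag z.2 == 1 then
    ((v z.1.1 (size z.1.2)).1 || has (fun j => (v z.1.2 j).2) (preds z.2),
     (v z.1.1 (size z.1.2)).2 || has (fun j => (v z.1.2 j).1) (preds z.2))
  else if gtag z.2 == 2 then
    ((v z.1.1 (size z.1.2)).1 || all (fun j => (v z.1.2 j).1) (preds z.2),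
     (v z.1.1 (size z.1.2)).2 || has (fun j => (v z.1.2 j).2) (preds z.2))
  else
    ((v z.1.1 (size z.1.2)).1 || has (fun j => (v z.1.2 j).1) (preds z.2),
     (v z.1.1 (size z.1.2)).2 || all (fun j => (v z.1.2 j).2) (preds z.2)))).
  by move=> [[o vs] [|j|js|js]] //=; rewrite !orbF.
by pt.
Qed.

Lemma ptime_proofs : ptime (fun z : seq gate * seq (bool * bool) => proofs z.1 z.2).
Proof.
rewrite /proofs; refine (ptime_sweep (x0 := (false, false))
  (h := fun z : seq gate * seq (bool * bool) => gate_prov z.2)
  (C := fun z => z.1) (c := 8) _ _ _).
- refine (ptime_comp3 (F := gate_prov) (f := fun z => z.1.1.2) (g := fun z => z.1.2)
    (h := fun z => z.2) ptime_gate_prov _ _ _); by pt.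
- by pt.
by move=> z P i; case: (nth _ _ _) => [[] []]; apply: leq_trans (leq_addr _ _).
Qed.
#[global] Hint Resolve ptime_proofs : ptime.

Lemma ptime_ax_cells : ptime (fun z : seq gate * seq (nat * nat) => ax_cells z.1 z.2).
Proof. by rewrite /ax_cells; pt. Qed.

Lemma ptime_ax_facts : ptime (fun z : seq gate * seq (nat * bool) => ax_facts z.1 z.2).
Proof. by rewrite /ax_facts; pt. Qed.

Lemma ptime_cell_ok : ptime (fun z : seq gate * nat * (nat * nat) => cell_ok z.1.1 z.1.2 z.2).
Proof. by rewrite /cell_ok; pt. Qed.

Lemma ptime_mono : ptime (fun z : seq (nat * nat) * seq (nat * nat) => mono z.1 z.2).
Proof. by rewrite /mono; pt. Qed.

Lemma ptime_unrefuted : ptime (fun z : seq (bool * bool) * (nat * bool) => unrefuted z.1 z.2).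
Proof. by rewrite /unrefuted; pt. Qed.
#[global] Hint Resolve ptime_ax_cells ptime_ax_facts ptime_cell_ok ptime_mono
  ptime_unrefuted : ptime.

Notation D := (seq (nat * nat) * seq (nat * bool))%type.

Lemma ptime_valid d : ptime (fun z : seq gate * nat * D => valid z.1.1 d z.1.2 z.2).
Proof.
apply: (@eq_ptime _ _ _ _ (fun z : seq gate * nat * D =>
  all (fun c => cell_ok z.1.1 z.1.2 c) z.2.1 && (mono z.2.1 z.2.1 &&
  (all (fun f => (f.1 < size z.1.1) ==> allowed_dec d z.1.1 f) z.2.2 &&
  (sel true (last (false, false) (proofs z.1.1 (ax_facts z.1.1 z.2.2))) &&
  all (fun f => unrefuted (proofs z.1.1 (ax_cells z.1.1 z.2.1)) f) z.2.2))))).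
  move=> z; rewrite /valid; do 2!congr (_ && _); congr (_ && _).
  by apply: eq_all => f; rewrite allowed_decE.
by pt.
Qed.

Lemma ptime_slot : ptime (fun u : D => slot u).
Proof. by rewrite /slot /unzip1; pt. Qed.
#[global] Hint Resolve ptime_slot : ptime.

Lemma ptime_compat : ptime (fun z : D * D => compat z.1 z.2).
Proof. by rewrite /compat; pt. Qed.
#[global] Hint Resolve ptime_compat : ptime.

(** Here [m] is a constant: the induction nests [m] maps, and the exponent of the time bound may
    depend on it. *)
Lemma ptime_allseq A X {EA : Enc A} {EX : Enc X} m (l : A -> seq X) :
  ptime l -> ptime (fun a => allseq m (l a)).
Proof.
move=> pl; elim: m => [|m IH]; rewrite /allseq; first by pt.
rewrite -/(allseq m).
refine (ptime_comp (@ptime_flatten _ _) _).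
apply: (@ptime_map _ _ _ _ _ _ (fun a x => [seq x :: s | s <- allseq m (l a)])) => //.
refine (ptime_map (f := fun z : A * X => fun s => z.2 :: s) _ _); first by pt.
exact: (ptime_comp IH (ptime_fst (A := A) (B := X))).
Qed.

Lemma ptime_slots d : ptime (slots d).
Proof. by rewrite /slots; apply: ptime_allseq; pt. Qed.
#[global] Hint Resolve ptime_slots : ptime.

Lemma ptime_descrs d : ptime (fun z : seq gate * nat => descrs z.1 d z.2).
Proof.
refine (ptime_filter (p := fun z u => valid z.1 d z.2 u) _ _); first exact: ptime_valid.
refine (ptime_comp (@ptime_flatten _ _) _).
refine (ptime_map (f := fun z cs => [seq (cs, w) | w <- allseq (2 ^ d)
  [seq (i, b) | i <- iota 0 (size z.1).+1, b <- [:: true; false]]]) _ _).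
  refine (ptime_map (f := fun z w => (z.2, w)) _ _); first by pt.
  by apply: ptime_allseq; pt.
by apply: ptime_allseq; pt.
Qed.
#[global] Hint Resolve ptime_descrs : ptime.

(** * Binary numerals *)

Fixpoint bsucc_rec (c : bool) (l : seq bool) : seq bool :=
  if l is x :: l' then (c (+) x) :: bsucc_rec (c && x) l'
  else if c then [:: true] else [::].

(** Successor with carry in tail-recursive form, collecting the output bits in reverse, as
    [ptime_foldl] requires. *)
Definition bsucc_step (st : bool * seq bool) (x : bool) : bool * seq bool :=
  (st.1 && x, (st.1 (+) x) :: st.2).

Lemma bsucc_foldl c acc l : let st := foldl bsucc_step (c, acc) l in
  rev (if st.1 then true :: st.2 else st.2) = rev acc ++ bsucc_rec c l.
Proof.
elim: l c acc => [|x l IH] c acc /=.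
  by case: c; rewrite ?cats0 // rev_cons cats1.
by rewrite IH /= rev_cons cat_rcons.
Qed.

Lemma size_bsucc_foldl c acc l :
  size (foldl bsucc_step (c, acc) l).2 = size acc + size l.
Proof. by elim: l c acc => [|x l IH] c acc /=; rewrite ?addn0 // IH /=; lia. Qed.

Lemma dsize_enc_bool (x : bool) : dsize (enc x) <= 3.
Proof. by case: x. Qed.

Lemma dsize_bits (l : seq bool) : dsize (enc l) <= 4 * size l + 1.
Proof.
elim: l => // x l IH; rewrite enc_cons dsize_Node /=.
by have := dsize_enc_bool x; lia.
Qed.

Lemma ptime_addb : ptime (fun p : bool * bool => p.1 (+) p.2).
Proof.
by apply: (@eq_ptime _ _ _ _ (fun p => if p.1 then ~~ p.2 else p.2)); [case=> [[] []] | pt].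
Qed.
#[global] Hint Resolve ptime_addb : ptime.

Lemma ptime_bsucc : ptime (bsucc_rec true).
Proof.
have pF : ptime (fun l : seq bool => foldl bsucc_step (true, [::]) l).
  apply: (@ptime_foldl _ _ _ _ _ _ (fun _ => bsucc_step) (fun=> (true, [::])) id).
  - by rewrite /bsucc_step; pt.
  - exact: ptime_const.
  - exact: ptime_id.
  exists (fun l => 4 * sz l + 10).
    have ? : pbounded (@sz (seq bool) _) by exact: pb_sz.
    by pb.
  move=> l i; have := size_bsucc_foldl true [::] (take i l).
  case: (foldl _ _ _) => [c acc] /= sza; rewrite enc_pair dsize_Node /=.
  have : size acc <= size l by rewrite sza size_take_min geq_minr.
  have : size l <= dsize (enc l) by exact: size_le_dsize.
  have := dsize_bits acc.
  by have := dsize_enc_bool c; rewrite /sz; lia.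
apply: (@eq_ptime _ _ _ _ (fun l => rev (if (foldl bsucc_step (true, [::]) l).1
   then true :: (foldl bsucc_step (true, [::]) l).2 else (foldl bsucc_step (true, [::]) l).2))).
  by move=> l; rewrite bsucc_foldl.
refine (ptime_comp (@ptime_rev _ _) _); refine (ptime_if _ _ _).
- exact: ptime_comp (@ptime_fst _ _ _ _) pF.
- apply: ptime_cons; [exact: ptime_const | exact: ptime_comp (@ptime_snd _ _ _ _) pF].
- exact: ptime_comp (@ptime_snd _ _ _ _) pF.
Qed.
#[global] Hint Resolve ptime_bsucc : ptime.

(** Counting up [n] times is affordable because the argument is given in unary. *)
Definition bits (n : nat) : seq bool := iter n (bsucc_rec true) [::].

Lemma size_bits n : size (bits n) <= n.
Proof.
have H c l : size (bsucc_rec c l) <= (size l).+1.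
  by elim: l c => [|x l IH] c /=; [case: c | rewrite ltnS].
by elim: n => //= n IH; apply: leq_trans (H _ _) _.
Qed.

Lemma ptime_bits : ptime bits.
Proof.
have E n : foldl (fun l (_ : unit) => bsucc_rec true l) [::] (units n) = bits n.
  rewrite /bits /units; elim: n [::] => //= n IH l; by rewrite IH -iterSr.
apply: (eq_ptime E).
apply: (@ptime_foldl _ _ _ _ _ _ (fun _ l _ => bsucc_rec true l) (fun=> [::])); try by pt.
exists (fun n => 4 * sz n + 1).
  have ? : pbounded (@sz nat _) by exact: pb_sz.
  by pb.
move=> n i; rewrite take_units E; apply: leq_trans (dsize_bits _) _.
rewrite leq_add2r leq_mul2l /=; apply: leq_trans (size_bits _) _.
by rewrite /sz dsize_enc_nat; lia.
Qed.
#[global] Hint Resolve ptime_bits : ptime.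

Fixpoint pos_bits (p : positive) : seq bool :=
  match p with
  | xH => [:: true]
  | xO q => false :: pos_bits q
  | xI q => true :: pos_bits q
  end.

Lemma enc_pos_bits p : enc (pos_bits p) = enc_pos p.
Proof. by elim: p => //= p IH; rewrite enc_cons IH. Qed.

Lemma bsucc_false l : bsucc_rec false l = l.
Proof. by elim: l => //= x l ->. Qed.

Lemma bsucc_pos p : bsucc_rec true (pos_bits p) = pos_bits (BinPos.Pos.succ p).
Proof. by elim: p => //= p IH; rewrite ?bsucc_false ?IH. Qed.

Lemma enc_bits n : enc (bits n) = enc_nat n.
Proof.
have H m : bits m = if bin_of_nat m is Npos p then pos_bits p else [::].
  elim: m => // m IH; rewrite /bits iterS -/(bits m) IH.
  have := bin_of_natK m; case: (bin_of_nat m) => [|p] <- //.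
  rewrite bsucc_pos -[(nat_of_bin _).+1]/((nat_of_pos p).+1) -nat_of_succ_pos.
  by rewrite -[nat_of_pos _]/(nat_of_bin (Npos _)) nat_of_binK.
by rewrite H /enc_nat; case: (bin_of_nat n) => // p; rewrite enc_pos_bits.
Qed.

(** * The instance built from views, as polynomial-time functions *)

Notation V := (nat * D)%type.

Definition dummy (t : seq nat) : D := ([seq (i, 0) | i <- t], [::]).

Lemma slot_dummy t : slot (dummy t) = t.
Proof. by rewrite /slot /unzip1 -map_comp map_id. Qed.

Definition vheavy (x y : V) : bool := heavy (D := descr) slot compat x y.
Definition vmember (t : seq nat) (x : V) : bool := member (D := descr) slot t x.

Definition vbound (U : seq D) (sl : seq (seq nat)) : nat :=
  3 * (size sl * size U) + size sl + 2.
Definition vbudget (U : seq D) (sl : seq (seq nat)) : nat :=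
  size sl * (3 * ((size sl).+1 * size U) + 2).
Definition vverts (U : seq D) (sl : seq (seq nat)) : seq V :=
  verts (D := descr) dummy U sl (vbound U sl).

Lemma ptime_vheavy : ptime (fun z : V * V => vheavy z.1 z.2).
Proof. by rewrite /vheavy /heavy; pt. Qed.

Lemma ptime_vmember : ptime (fun z : seq nat * V => vmember z.1 z.2).
Proof. by rewrite /vmember /member; pt. Qed.

Lemma ptime_vverts : ptime (fun z : seq D * seq (seq nat) => vverts z.1 z.2).
Proof. by rewrite /vverts /verts /vbound /dummy; pt. Qed.

Lemma ptime_vbudget : ptime (fun z : seq D * seq (seq nat) => vbudget z.1 z.2).
Proof. by rewrite /vbudget; pt. Qed.
#[global] Hint Resolve ptime_vheavy ptime_vmember ptime_vverts ptime_vbudget : ptime.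

Definition check d (x : data) : bool :=
  wf x && (circuit_ok (dec x) && ((weft (dec x) <= 1) && (depth (dec x) <= d))).

(** Without candidates no index tuple can be served, so an inadmissible input is sent to an
    unsolvable instance. *)
Definition candidates d (x : data) (k : nat) : seq D :=
  if check d x then descrs (dec x) d k else [::].

Lemma ptime_check d : ptime (check d).
Proof. by rewrite /check; pt. Qed.
#[global] Hint Resolve ptime_check : ptime.

Lemma ptime_candidates d : ptime (fun z : data * nat => candidates d z.1 z.2).
Proof.
rewrite /candidates; refine (ptime_if _ _ _); [by pt | | by pt].
by refine (ptime_comp (ptime_descrs d) (f := fun z : data * nat => (dec z.1, z.2)) _); pt.
Qed.

Definition v0 : V := (0, ([::], [::])).

Definition entry (w1 w2 : data) (vs : seq V) (i j : nat) : data :=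
  if i == j then Leaf else if vheavy (nth v0 vs i) (nth v0 vs j) then w2 else w1.

(** The trees [w1] and [w2] stand for matrix entries of weight 1 and 2, and [w3] for the denominator
    of the budget; as parameters they are constants of the program. *)
Definition output (w1 w2 w3 : data) (U : seq D) (sl : seq (seq nat)) :=
  let vs := vverts U sl in let I := iota 0 (size vs) in
  let b := bits (vbudget U sl) in
  ((([seq [seq entry w1 w2 vs i j | j <- I] | i <- I],
     [seq [seq vmember t (nth v0 vs i) | i <- I] | t <- sl]),
    ((Leaf, b), ((Leaf, b), w3))), size sl).

Lemma ptime_output w1 w2 w3 :
  ptime (fun z : seq D * seq (seq nat) => output w1 w2 w3 z.1 z.2).
Proof. by rewrite /output /entry; cbv zeta; pt. Qed.

Definition reduce w1 w2 w3 d (z : data * nat) :=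
  output w1 w2 w3 (candidates d z.1 z.2) (slots d z.2).

Lemma ptime_reduce w1 w2 w3 d : ptime (reduce w1 w2 w3 d).
Proof.
refine (ptime_comp2 (F := output w1 w2 w3) (f := fun z => candidates d z.1 z.2)
  (g := fun z => slots d z.2) _ _ _).
- exact: ptime_output.
- exact: ptime_candidates.
- by pt.
Qed.

(** * Composition with an fpt-reduction *)

Fixpoint evars_lt n (e : expr) : bool :=
  match e with
  | EVar x => x < n
  | ELeaf => true
  | ENode e1 e2 => evars_lt n e1 && evars_lt n e2
  | EHd e1 | ETl e1 => evars_lt n e1
  end.

Fixpoint cvars_lt n (c : cmd) : bool :=
  match c with
  | Skip => true
  | Assign x e => (x < n) && evars_lt n e
  | Seq c1 c2 => cvars_lt n c1 && cvars_lt n c2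
  | If e c1 c2 => [&& evars_lt n e, cvars_lt n c1 & cvars_lt n c2]
  | While e c1 => evars_lt n e && cvars_lt n c1
  end.

Lemma evars_lt_mono n m e : n <= m -> evars_lt n e -> evars_lt m e.
Proof.
move=> nm; elim: e => //= [x|e1 IH1 e2 IH2 /andP[/IH1-> /IH2->]] //.
by move/leq_trans; apply.
Qed.

Lemma cvars_lt_mono n m c : n <= m -> cvars_lt n c -> cvars_lt m c.
Proof.
move=> nm; have em e := @evars_lt_mono n m e nm.
elim: c => //= [x e /andP[xn /em->]|c1 IH1 c2 IH2 /andP[/IH1-> /IH2->]|
  e c1 IH1 c2 IH2 /and3P[/em-> /IH1-> /IH2->]|e c IH /andP[/em-> /IH->]] //.
by rewrite (leq_trans xn nm).
Qed.

Lemma ex_evars_lt e : exists n, evars_lt n e.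
Proof.
elim: e => /= [x||e1 [n1 H1] e2 [n2 H2]|//|//]; first by exists x.+1.
  by exists 0.
exists (maxn n1 n2); rewrite (evars_lt_mono _ H1) ?leq_maxl //.
by rewrite (evars_lt_mono _ H2) ?leq_maxr.
Qed.

Lemma ex_cvars_lt c : exists n, cvars_lt n c.
Proof.
elim: c => /= [|x e|c1 [n1 H1] c2 [n2 H2]|e c1 [n1 H1] c2 [n2 H2]|e c [n1 H1]].
- by exists 0.
- have [n H] := ex_evars_lt e; exists (maxn x.+1 n).
  by rewrite leq_maxl (evars_lt_mono _ H) ?leq_maxr.
- exists (maxn n1 n2); rewrite (cvars_lt_mono _ H1) ?leq_maxl //.
  by rewrite (cvars_lt_mono _ H2) ?leq_maxr.
- have [n H] := ex_evars_lt e; exists (maxn n (maxn n1 n2)).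
  rewrite (evars_lt_mono _ H) ?leq_maxl // (cvars_lt_mono _ H1) ?(cvars_lt_mono _ H2) //.
    by rewrite !leq_max leqnn !orbT.
  by rewrite !leq_max leqnn !orbT.
- have [n H] := ex_evars_lt e; exists (maxn n n1).
  by rewrite (evars_lt_mono _ H) ?leq_maxl // (cvars_lt_mono _ H1) ?leq_maxr.
Qed.

Lemma eval_agree n e (s r : store) : evars_lt n e ->
  (forall x, x < n -> r x = s x) -> eval r e = eval s e.
Proof.
move=> + H; elim: e => //= [e1 IH1 e2 IH2 /andP[/IH1-> /IH2->]//|e IH /IH->//|e IH /IH->//].
Qed.

(** An arbitrary program comes without a frame condition, but it mentions only finitely many
    variables. A value saved above them survives and does not influence the run. *)
Lemma exec_frame n c s t s' : exec c s t s' -> cvars_lt n c ->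
  forall r : store, (forall x, x < n -> r x = s x) ->
  exists r', [/\ exec c r t r', forall x, x < n -> r' x = s' x
               & forall x, n <= x -> r' x = r x].
Proof.
elim=> {c s t s'}.
- by move=> s _ r rs; exists r; split=> //; constructor.
- move=> s x e /= /andP[xn en] r rs; exists (upd r x (eval r e)).
  rewrite -(eval_agree en rs); split; first exact: ExAssign.
    by move=> y yn; rewrite /upd; case: eqP => // _; apply: rs.
  by move=> y ny; rewrite upd_neq //; lia.
- move=> c1 c2 s s1 s2 t1 t2 _ IH1 _ IH2 /= /andP[n1 n2] r rs.
  have [r1 [e1 a1 f1]] := IH1 n1 r rs; have [r2 [e2 a2 f2]] := IH2 n2 r1 a1.
  exists r2; split=> //; first exact: ExSeq e1 e2.
  by move=> x nx; rewrite f2 ?f1.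
- move=> e c1 c2 s s1 t te _ IH /= /and3P[en n1 n2] r rs.
  have [r1 [e1 a1 f1]] := IH n1 r rs; exists r1; split=> //.
  by apply: ExIfTrue e1; rewrite (eval_agree en rs).
- move=> e c1 c2 s s1 t te _ IH /= /and3P[en n1 n2] r rs.
  have [r1 [e1 a1 f1]] := IH n2 r rs; exists r1; split=> //.
  by apply: ExIfFalse e1; rewrite (eval_agree en rs).
- move=> e c s s1 s2 t1 t2 te _ IH1 _ IH2 nn r rs; have /andP[en nc] := nn.
  have [r1 [e1 a1 f1]] := IH1 nc r rs; have [r2 [e2 a2 f2]] := IH2 nn r1 a1.
  exists r2; split=> //; last by move=> x nx; rewrite f2 ?f1.
  by apply: ExWhileTrue e1 e2; rewrite (eval_agree en rs).
- move=> e c s te /= /andP[en nc] r rs; exists r; split=> //.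
  by apply: ExWhileFalse; rewrite (eval_agree en rs).
Qed.

Lemma computable_ptime (f : nat -> nat) (F : nat * nat -> nat) :
  computable f -> ptime F -> computable (fun k => F (f k, k)).
Proof.
move=> [p Hp] [P [T [_ HP]]]; have [n0 nv0] := ex_cvars_lt p.
(* The successor keeps the variable [n], where the input is saved, distinct from variable 0. *)
pose n := n0.+1; have nv : cvars_lt n p by apply: cvars_lt_mono nv0.
exists (Seq (Assign n (EVar 0)) (Seq p (Seq (Assign 0 (ENode (EVar 0) (EVar n))) (P 0)))).
move=> k; have [t [s ex sE]] := Hp k.
pose s0 : store := upd (fun=> Leaf) 0 (enc_unary k).
have agr x : x < n -> upd s0 n (s0 0) x = s0 x by move=> xn; rewrite upd_neq //; lia.
have [r [exr ar fr]] := exec_frame ex nv agr.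
have rn : r n = enc k by rewrite fr // upd_eq.
have r0 : r 0 = enc (f k) by rewrite ar.
have [|t2 [s2 [ex2 eq2 _ _]]] := HP 0 (upd r 0 (Node (r 0) (r n))) (f k, k).
  by rewrite upd_eq r0 rn.
eexists; exists s2; last exact: eq2.
apply: ExSeq; first exact: ExAssign.
apply: ExSeq exr _; apply: ExSeq; first exact: ExAssign.
exact: ex2.
Qed.

Lemma ptime_exp n : ptime (fun m => m ^ n).
Proof.
elim: n => [|n IH]; first exact: ptime_const.
apply: (@eq_ptime _ _ _ _ (fun m => m * m ^ n)) => [m|]; first by rewrite expnS.
exact: (ptime_comp2 (F := muln) ptime_muln ptime_id IH).
Qed.

(** The second program runs in the store left by the first. Its argument has size at most the
    elapsed time plus the size of the input. *)
Lemma fpt_time_ptime X {EX : Enc X} (r : data -> nat -> data * nat)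
    (F : data * nat -> X * nat) :
  fpt_time r -> ptime F -> fpt_time (fun x k => (enc (F (r x k)).1, (F (r x k)).2)).
Proof.
move=> [p [f [c [cf Hp]]]] [P [T [[e Te] HP]]].
(* The size of the intermediate result is at most [f k + 2 * k + 4] times a power of [dsize x]; its
   [e]-th power again splits into a function of [k] and a power of [dsize x]. *)
pose h k := f k + (f k + 2 * k + 4) ^ e + 1.
exists (Seq p (P 0)), h, (c.+1 * e.+1); split.
  apply: (@computable_ptime f (fun z => z.1 + (z.1 + 2 * z.2 + 4) ^ e + 1) cf).
  have pe : ptime (fun z : nat * nat => (z.1 + 2 * z.2 + 4) ^ e).
    by refine (ptime_comp (ptime_exp e) (f := fun z : nat * nat => z.1 + 2 * z.2 + 4) _); pt.
  refine (ptime_comp2 (F := addn) ptime_addn _ _); last by pt.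
  by refine (ptime_comp2 (F := addn) ptime_addn _ pe); pt.
move=> x k; have [t [s ex sE] le_t] := Hp x k.
have [|t2 [s2 [ex2 eq2 _ le2]]] := HP 0 s (r x k); first by rewrite sE.
exists (t + t2).+1; first by exists s2; [exact: ExSeq ex ex2 | rewrite eq2].
set X0 := dsize x; have X1 : 0 < X0 by exact: dsize_gt0.
have pw a b : a <= b -> X0 ^ a <= X0 ^ b by move=> ab; rewrite leq_pexp2l.
have szle : sz (r x k) <= (f k + 2 * k + 4) * X0 ^ c.+1.
  have : sz (r x k) <= t + (X0 + 2 * k + 3).
    rewrite /sz -[enc (r x k)]sE; case: (exec_size ex 0) => [->|]; last by lia.
    rewrite /upd eqxx dsize_Node -/X0.
    have -> : dsize (enc_unary k) = k.*2.+1 by exact: dsize_enc_nat.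
    by lia.
  move/leq_trans; apply.
  have h1 : X0 ^ c <= X0 ^ c.+1 by exact: pw.
  have h2 : X0 <= X0 ^ c.+1 by rewrite -{1}(expn1 X0); apply: pw.
  have h3 : f k * X0 ^ c <= f k * X0 ^ c.+1 by rewrite leq_mul2l h1 orbT.
  have h4 : 2 * k + 3 <= (2 * k + 3) * X0 ^ c.+1 by apply: leq_pmulr; rewrite expn_gt0 X1.
  move: (X0 ^ c.+1) (f k * X0 ^ c) le_t h2 h3 h4 => Y Z ? ? ? ?; nia.
have le_t2 : t2 <= (f k + 2 * k + 4) ^ e * X0 ^ (c.+1 * e.+1).
  apply: leq_trans le2 _; apply: leq_trans (Te _) _.
  apply: (@leq_trans (((f k + 2 * k + 4) * X0 ^ c.+1) ^ e)).
    by case: (e) => // e'; rewrite leq_exp2r.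
  by rewrite expnMn leq_mul2l -expnM pw ?orbT // leq_mul2l leqnSn orbT.
have le_t1 : t <= f k * X0 ^ (c.+1 * e.+1).
  apply: leq_trans le_t _; rewrite leq_mul2l pw ?orbT //; nia.
have : 0 < X0 ^ (c.+1 * e.+1) by rewrite expn_gt0 X1.
rewrite /h; move: (X0 ^ (c.+1 * e.+1)) ((f k + 2 * k + 4) ^ e) le_t1 le_t2 => Y Z ? ? ?; nia.
Qed.

(** * Correctness of the reduction *)

Import Order.TTheory GRing.Theory Num.Theory.

(** Every edge weighs at least 1, so choosing the edge bound equal to the budget lets the budget
    imply it. *)
Definition gstars (U : seq descr) (sl : seq (seq nat)) : stars rat :=
  @Stars rat (size (vverts U sl)) (gedges (size (vverts U sl)))
    [seq gcomm (D := descr) slot dummy U sl t | t <- sl]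
    (fun e => (@gweight descr (seq nat) slot compat dummy U sl e)%:R%R)
    (vbudget U sl)%:Z (vbudget U sl)%:R%R.

Definition weight_code (n : nat) : data := Node Leaf (enc_rat n%:R%R).

Lemma enc_int_nat n : enc_int n%:Z = Node Leaf (enc_nat n).
Proof. by rewrite /enc_int absz_nat. Qed.

Lemma enc_rat_nat n : enc_rat n%:R%R = Node (Node Leaf (enc_nat n)) (enc_nat 1).
Proof. by rewrite /enc_rat pmulrn numq_int denq_int enc_int_nat. Qed.

Lemma enc_list_ord X {EX : Enc X} N (f : 'I_N -> data) (g : nat -> X) :
  (forall u : 'I_N, f u = enc (g u)) ->
  enc_list f (enum 'I_N) = enc [seq g i | i <- iota 0 N].
Proof.
move=> fg; rewrite -val_enum_ord -map_comp.
by elim: (enum 'I_N) => //= u l IH; rewrite IH fg.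
Qed.

Lemma enc_list_map X Y {EX : Enc X} (f : Y -> data) (g : Y -> X) s :
  (forall y, f y = enc (g y)) -> enc_list f s = enc [seq g y | y <- s].
Proof. by move=> fg; elim: s => //= y s ->; rewrite fg. Qed.

Lemma enc_list_comp X Y (f : Y -> data) (g : X -> Y) s :
  enc_list f [seq g x | x <- s] = enc_list (f \o g) s.
Proof. by elim: s => //= x s ->. Qed.

Lemma enc_gstars U sl : enc_stars (gstars U sl) =
  enc (output (weight_code 1) (weight_code 2) (enc_nat 1) U sl).1.
Proof.
rewrite /enc_stars /=; congr (Node (Node _ _) _).
- apply: enc_list_ord => u; apply: enc_list_ord => v; rewrite inE cards2 /entry.
  case: (eqVneq u v) => [->|neq]; first by rewrite eqxx.
  rewrite (inj_eq val_inj) (negbTE neq) /= gweight2 //; last exact: compatC.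
  rewrite !(tnth_nth v0) /= -/(vbound U sl) -/(vverts U sl) -/(vheavy _ _).
  by case: (vheavy _ _).
- rewrite enc_list_comp; apply: enc_list_map => t /=.
  apply: enc_list_ord => v; rewrite inE (tnth_nth v0) /=.
  by [].
- by rewrite enc_int_nat enc_rat_nat -!enc_bits.
Qed.

Section Real.
Variable R : realType.

Lemma gstars_solvable U sl : uniq sl ->
  stars_solvable (real_stars R (gstars U sl)) <-> solvable_choice slot compat U sl.
Proof.
move=> usl; rewrite -(gadget_solvable U compatC compatxx slot_dummy usl).
have sumE (F : {set {set 'I_(nverts (gstars U sl))}}) :
   (\sum_(e in F) weight (real_stars R (gstars U sl)) e <=
     budget (real_stars R (gstars U sl)))%R =
   (\sum_(e in F) gweight (D := descr) slot compat e <= vbudget U sl).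
  rewrite /= ratr_nat -(ler_nat R) natr_sum; congr (_ <= _)%R.
  by apply: eq_bigr => e _; rewrite ratr_nat.
split=> [[F [Fsub _ H2 st]]|[F [Fsub H1 st]]]; exists F; split=> //.
- by rewrite sumE in H2.
- by move=> t tin; apply: st; exact: map_f.
- rewrite /= lez_nat; apply: leq_trans _ H1; rewrite -sum1_card.
  by apply: leq_sum => e _; rewrite /gweight leq_addr.
- by rewrite sumE.
- by move=> C /mapP[t tin ->]; apply: st.
Qed.

Lemma gstars_valid U sl : uniq sl -> 0 < size sl ->
  valid_stars (real_stars R (gstars U sl)).
Proof.
move=> usl sl0; split.
- by move=> e; rewrite inE => /eqP.
- rewrite map_inj_in_uniq // => t t' tin tin' E.
  (* A private vertex of [t] lies in no other community, which tells the communities apart. *)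
  have : (2, dummy t) \in vverts U sl.
    rewrite !mem_cat; apply/orP; right; apply/orP; right; apply/allpairsP.
    by exists (t, 0); split=> //; rewrite mem_iota /= /vbound addn2.
  case/(tnthP (in_tuple _)) => v vE.
  have : v \in gcomm (D := descr) slot dummy U sl t.
    by rewrite inE /member -vE slot_dummy eqxx orbT.
  by rewrite E inE /member -vE slot_dummy => /eqP.
- by move=> e _; rewrite /= ratr_nat ler0n.
- by rewrite /= ratr_nat ltr0n /vbudget muln_gt0 sl0 addn2.
Qed.

Lemma gstars_clique_instance U sl : uniq sl -> 0 < size sl ->
  clique_instances_1_2 R (enc_stars (gstars U sl)) (size sl).
Proof.
move=> usl sl0; exists (real_stars R (gstars U sl)); split.
- by exists (gstars U sl).
- exact: gstars_valid.
- by rewrite size_map.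
- by move=> u v neq; rewrite inE cards2 neq.
- move=> e _; rewrite /= ratr_nat /gweight; case: [exists u, _]; [by right | by left].
Qed.

(** * Injectivity of the encodings *)

Lemma enc_pos_inj : injective enc_pos.
Proof.
elim=> [p IH|p IH|] [q|q|] //= [].
- by move/IH->.
- by case: p {IH}.
- by move/IH->.
- by case: q.
Qed.

Lemma enc_nat_inj : injective enc_nat.
Proof.
move=> m n; rewrite /enc_nat -{2}(bin_of_natK m) -{2}(bin_of_natK n).
case: (bin_of_nat m) => [|p]; case: (bin_of_nat n) => [|q] //.
- by case: q.
- by case: p.
- by move/enc_pos_inj->.
Qed.

Lemma enc_bool_inj : injective enc_bool. Proof. by case=> [] []. Qed.

Lemma enc_int_inj : injective enc_int.
Proof.
move=> x y [/enc_bool_inj sg /enc_nat_inj].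
by case: x y sg => m [] n //= _; [move=> -> | case=> ->].
Qed.

Lemma enc_rat_inj : injective enc_rat.
Proof.
move=> x y [/enc_bool_inj sg /enc_nat_inj nm /enc_nat_inj dn].
have en : numq x = numq y by apply: enc_int_inj; rewrite /enc_int sg nm.
have ed : denq x = denq y by rewrite -(absz_denq x) -(absz_denq y) dn.
by rewrite -(divq_num_den x) -(divq_num_den y) en ed.
Qed.

Lemma enc_list_inj T T' (f : T -> data) (g : T' -> data) s t :
  enc_list f s = enc_list g t -> map f s = map g t.
Proof. by move/(congr1 dlist); rewrite !dlist_enc_list. Qed.

(** Membership in [stars_nws] only asks for some solvable instance with the given encoding, so
    solvability must be shown to depend on the encoding alone. As edges have two elements, the
    matrix determines the edge set and the weights on it. *)
Lemma enc_stars_solvable (J J' : stars rat) :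
  (forall e, e \in edges J -> #|e| = 2) -> (forall e, e \in edges J' -> #|e| = 2) ->
  enc_stars J = enc_stars J' ->
  stars_solvable (real_stars R J) -> stars_solvable (real_stars R J').
Proof.
case: J => n E cs w l b; case: J' => n' E' cs' w' l' b' /= cE cE'.
rewrite /enc_stars /= => eJ.
have {eJ} [eM eC /enc_int_inj el /enc_rat_inj eb] :
  [/\ dhd (dhd (enc_stars (Stars E cs w l b))) = dhd (dhd (enc_stars (Stars E' cs' w' l' b'))),
      dtl (dhd (enc_stars (Stars E cs w l b))) = dtl (dhd (enc_stars (Stars E' cs' w' l' b'))),
      enc_int l = enc_int l' & enc_rat b = enc_rat b'].
  case: eJ => a1 a2 a3 a4 a5 a6 a7.
  by split=> //; rewrite /enc_rat /enc_int ?a3 ?a4 ?a5 ?a6 ?a7.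
rewrite -{}el -{}eb; move: eM eC => /= /enc_list_inj eM /enc_list_inj eC.
have en : n = n'.
  have /(congr1 size) := eM.
  by rewrite (size_map _ (enum 'I_n)) (size_map _ (enum 'I_n')) !size_enum_ord.
case: n' / en E' cs' w' cE' eM eC => E' cs' w' cE' eM eC.
have ent u v : (if [set u; v] \in E then Node Leaf (enc_rat (w [set u; v])) else Leaf) =
               (if [set u; v] \in E' then Node Leaf (enc_rat (w' [set u; v])) else Leaf).
  have /eq_in_map/(_ u) := eM; rewrite mem_enum => /(_ isT)/enc_list_inj.
  by move/eq_in_map/(_ v); rewrite mem_enum => /(_ isT).
have eE (e : {set 'I_n}) : #|e| = 2 -> (e \in E) = (e \in E') /\ (e \in E -> w e = w' e).
  move/eqP/cards2P => [u [v [_ ->]]]; have := ent u v.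
  case: (_ \in E); case: (_ \in E') => //.
  by move/(congr1 dtl)/enc_rat_inj.
have EE : E = E'.
  apply/setP => e; case: (boolP (e \in E)) => [/[dup]/cE/eE[<- _] ->//|].
  by case: (boolP (e \in E')) => // /[dup]/cE'/eE[<- _] ->.
have ec : cs = cs'.
  move: eC; elim: cs cs' => [|c cs0 IH] [|c' cs0'] //= [/enc_list_inj ec /IH->].
  congr (_ :: _); apply/setP => v; apply: enc_bool_inj.
  by have /eq_in_map/(_ v) := ec; rewrite mem_enum; apply.
rewrite -{}ec -{cE'}EE => -[F [Fsub H1 H2 st]]; exists F; split=> //=.
rewrite /= in Fsub H2; rewrite (eq_bigr (fun e => ratr (w e))) // => e eF.
by have eE' := subsetP Fsub e eF; have [_ ->] := eE e (cE e eE').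
Qed.

Lemma wcs_check d x k : wcs 1 d x k <-> check d x /\ weighted_sat (dec x) k.
Proof.
split=> [[C [-> okC w1 dd sat]]|[/and4P[wfx okC w1 dd] sat]].
  by rewrite /check dec_enc wf_enc okC w1 dd.
by exists (dec x); rewrite wf_dec.
Qed.

Lemma uniq_slots d k : uniq (slots d k).
Proof. by apply: uniq_allseq; exact: iota_uniq. Qed.

Lemma size_allseq T m (l : seq T) : size (allseq m l) = size l ^ m.
Proof. by elim: m => //= m IH; rewrite size_allpairs IH expnS. Qed.

Lemma size_slots d k : size (slots d k) = k.+2 ^ (2 ^ d.+1).
Proof. by rewrite size_allseq size_iota. Qed.

Lemma size_slots_gt0 d k : 0 < size (slots d k).
Proof. by rewrite size_slots expn_gt0. Qed.

(** Choices indexed by positions in [slots] correspond to functions on index tuples through [index],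
    as the tuples are distinct. *)
Lemma solvable_choice_csp C d k :
  solvable_choice slot compat (descrs C d k) (slots d k) <-> csp C d k.
Proof.
pose K := size (slots d k); pose sg (i : 'I_K) := tnth (in_tuple (slots d k)) i.
have sgin i : sg i \in slots d k by exact: mem_tnth.
split=> [[u Hu]|[phi Hp]]; last first.
  exists (fun i => phi (sg i)) => i; have [pin ps pc] := Hp _ (sgin i).
  split=> // j neq; apply: pc => //; apply: contra neq => /eqP E.
  by apply/eqP; move: E; apply/tuple_uniqP; exact: uniq_slots.
pose phi t := nth (dummy t) [seq u i | i <- enum 'I_K] (index t (slots d k)).
have phiE i : phi (sg i) = u i.
  rewrite /phi /sg (tnth_nth [::]) index_uniq ?uniq_slots //.
  by rewrite (nth_map i) ?size_enum_ord // nth_ord_enum.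
exists phi => t /(tnthP (in_tuple (slots d k)))[i ->].
rewrite phiE; have [ui us uc] := Hu i; split=> // t' /(tnthP (in_tuple _))[j ->] neq.
by rewrite phiE; apply: uc; apply: contra neq => /eqP->.
Qed.

Lemma candidates_solvable d x k :
  solvable_choice slot compat (candidates d x k) (slots d k) <-> wcs 1 d x k.
Proof.
rewrite wcs_check /candidates; case E: (check d x); last first.
  split=> [[u Hu]|[] //]; have [] := Hu (Ordinal (size_slots_gt0 d k)).
  by rewrite in_nil.
case/and4P: E => _ okC w1 dd; rewrite solvable_choice_csp csp_sat //.
by split=> [|[]].
Qed.

Definition reduction d (y : data * nat) : data * nat :=
  let o := reduce (weight_code 1) (weight_code 2) (enc_nat 1) d y in (enc o.1, o.2).

Lemma reductionE d y : reduction d y =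
  (enc_stars (gstars (candidates d y.1 y.2) (slots d y.2)), size (slots d y.2)).
Proof. by rewrite /reduction enc_gstars. Qed.

Lemma reduction_clique d y :
  clique_instances_1_2 R (reduction d y).1 (reduction d y).2.
Proof.
by rewrite reductionE; apply: gstars_clique_instance; [exact: uniq_slots | exact: size_slots_gt0].
Qed.

Lemma reduction_correct d x k :
  wcs 1 d x k <-> stars_nws R (reduction d (x, k)).1 (reduction d (x, k)).2.
Proof.
rewrite -candidates_solvable -(gstars_solvable _ (uniq_slots d k)) reductionE /=.
set J := gstars _ _; have vJ : valid_stars (real_stars R J).
  by apply: gstars_valid; [exact: uniq_slots | exact: size_slots_gt0].
split=> [solv|[I [[J' eJ ->] [cJ' _ _ _] _ solv]]].
  exists (real_stars R J); split=> //; first by exists J.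
  by rewrite size_map.
by apply: enc_stars_solvable (esym eJ) solv => //; case: vJ.
Qed.

End Real.

Theorem theorem23 (R : realType) :
  W_hard_on 1 (stars_nws R) (clique_instances_1_2 R).
Proof.
move=> A [d _ [r [rA [g cg rg] tr]]].
exists (fun x k => reduction d (r x k)); last by move=> x k; exact: reduction_clique.
split.
- move=> x k; rewrite rA [X in reduction d X]surjective_pairing.
  exact: reduction_correct.
(* The new parameter is the number of index tuples for the parameter of the circuit instance, which
   [g] bounds. *)
- exists (fun k => (g k).+2 ^ (2 ^ d.+1)).
    apply: (@computable_ptime g (fun z => z.1.+2 ^ (2 ^ d.+1)) cg).
    by refine (ptime_comp (ptime_exp _) (f := fun z : nat * nat => z.1.+2) _); pt.
  move=> x k; rewrite reductionE size_slots leq_exp2r ?expn_gt0 //.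
  exact: rg.
- exact: fpt_time_ptime tr (ptime_reduce _ _ _ d).
Qed.
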